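(* Let $f(x,y)\in\mathbb{Q}[x,y]$ be an irreducible polynomial of degree $d$ and order $m$, let $\tilde f(x,y,z)$ be its homogenization (homogeneous of degree $d$, with $\tilde f(x,y,1)=f(x,y)$), and let $X\subset\mathbb{P}^2_{\mathbb{Q}}$ be the plane curve $\tilde f=0$. Then for every $\epsilon,\delta>0$, there exist positive constants $C_1',C_2'$ such that for all triplets $(x,y,z)\ne(0,0,0),(0,0,\pm1)$ of integers satisfying $\gcd(x,y,z)=1$, $\tilde f(x,y,z)=0$ and $\max\{|x/z|,|y/z|\}\ge\delta$, we have $$C_1'\max\{|x|,|y|\}^{m/d-\epsilon}\le\gcd(x,y)\le C_2'\max\{|x|,|y|\}^{m/d+\epsilon}.$$ Moreover, if $X$ is rational, then we can replace $\epsilon$ with zero.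
   Context: The order of $f$ is the smallest total degree of a monomial occurring in $f$ with nonzero coefficient (i.e. the multiplicity of the curve $f=0$ at the origin; it is $0$ if $f(0,0)\neq0$). $|\cdot|$ is the usual absolute value. If $z=0$, the quantity $\max\{|x/z|,|y/z|\}$ is interpreted as $+\infty$. $X$ is rational if it is birational to $\mathbb{P}^1_{\mathbb{Q}}$. *)

(* Defs.v *)
From HB Require Import structures.
From mathcomp Require Import all_boot all_order all_algebra.
From mathcomp Require Import mpoly.
From mathcomp Require Import constructive_ereal reals exp.

Set Implicit Arguments.
Unset Strict Implicit.
Unset Printing Implicit Defensive.

Import Order.TTheory GRing.Theory Num.Theory.
Local Open Scope ring_scope.

Section Polynomials.
Variable K : fieldType.

Definition mirreducible n (f : {mpoly K[n]}) : Prop :=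
  [/\ f != 0, f \isn't a GRing.unit &
      forall g h : {mpoly K[n]},
        f = g * h -> g \is a GRing.unit \/ h \is a GRing.unit].

(* [msize] is the total degree plus one, and [msize 0 = 0]. *)
Definition has_degree n (f : {mpoly K[n]}) (d : nat) : Prop := msize f = d.+1.

Definition has_order n (f : {mpoly K[n]}) (m : nat) : Prop :=
  (exists2 a, a \in msupp f & mdeg a = m) /\
  (forall a, a \in msupp f -> (m <= mdeg a)%N).

(* The variables of [{mpoly K[2]}] are ['X_0 = x] and ['X_1 = y]; those of
   [{mpoly K[3]}] are ['X_0 = x], ['X_1 = y] and ['X_2 = z]. *)
Definition homogenize (f : {mpoly K[2]}) : {mpoly K[3]} :=
  \sum_(a <- msupp f)
     f@_a *: ('X_0 ^+ a 0%R * 'X_1 ^+ a 1%R * 'X_2 ^+ ((msize f).-1 - mdeg a)).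

Lemma homogenize_homog (f : {mpoly K[2]}) :
  homogenize f \is (msize f).-1.-homog.
Proof.
rewrite /homogenize big_seq; apply: rpred_sum => a af; apply: rpredZ.
have -> : (msize f).-1 = (mdeg a + ((msize f).-1 - mdeg a))%N.
  rewrite subnKC //; have := msize_mdeg_lt af.
  by case: (msize f).
have -> : mdeg a = (a 0%R + a 1%R)%N.
  by rewrite mdegE !big_ord_recl big_ord0 addn0; congr (a _ + a _)%N;
    apply/val_inj.
rewrite addKn.
have homogXn i k : ('X_i ^+ k : {mpoly K[3]}) \is k.-homog.
  rewrite -[X in X.-homog]mul1n; apply: dhomogMn.
  by rewrite dhomogX; apply/eqP; apply: mdeg1.
by apply: dhomogM; first apply: dhomogM.
Qed.

Lemma homogenizeK (f : {mpoly K[2]}) :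
  homogenize f \mPo [tuple 'X_0; 'X_1; 1] = f.
Proof.
rewrite {2}(mpolyE f) /homogenize raddf_sum /=; apply: eq_bigr => a _.
rewrite comp_mpolyZ !rmorphM !rmorphXn /= !comp_mpolyXU /= expr1n mulr1.
congr (_ *: _); rewrite [in RHS]mpolyXE_id !big_ord_recl big_ord0 mulr1.
by congr ('X_ _ ^+ a _ * 'X_ _ ^+ a _); apply/val_inj.
Qed.

(* A closed subvariety of P^(n-1) is given by its homogeneous prime ideal [I],
   as a membership predicate on [{mpoly K[n]}].  A rational map from V(I) to
   V(J) is given by forms [p] of the same degree that are not all zero on V(I)
   and map V(I) into V(J). *)
Definition rational_map n k (I : {mpoly K[n]} -> Prop)
    (J : {mpoly K[k]} -> Prop) (p : k.-tuple {mpoly K[n]}) : Prop :=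
  [/\ exists e : nat, forall i, tnth p i \is e.-homog,
      exists i, ~ I (tnth p i) &
      forall g, J g -> I (g \mPo p)].

Definition comp_tuple n k l (q : l.-tuple {mpoly K[k]})
    (p : k.-tuple {mpoly K[n]}) : l.-tuple {mpoly K[n]} :=
  [tuple tnth q i \mPo p | i < l].

(* [p] is defined as a rational map on V(I), and there
   [(p_0 : ... : p_(n-1)) = (X_0 : ... : X_(n-1))]. *)
Definition is_identity_map n (I : {mpoly K[n]} -> Prop)
    (p : n.-tuple {mpoly K[n]}) : Prop :=
  (exists i, ~ I (tnth p i)) /\
  (forall i j, I (tnth p i * 'X_j - tnth p j * 'X_i)).

Definition birational n k (I : {mpoly K[n]} -> Prop)
    (J : {mpoly K[k]} -> Prop) : Prop :=
  exists (p : k.-tuple {mpoly K[n]}) (q : n.-tuple {mpoly K[k]}),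
    [/\ rational_map I J p, rational_map J I q,
        is_identity_map I (comp_tuple q p) &
        is_identity_map J (comp_tuple p q)].

Definition principal_ideal n (f : {mpoly K[n]}) : {mpoly K[n]} -> Prop :=
  fun g => exists h, g = f * h.

(* The zero ideal of [{mpoly K[2]}] is the ideal of P^1. *)
Definition rational_curve (F : {mpoly K[3]}) : Prop :=
  birational (principal_ideal F) (fun g : {mpoly K[2]} => g = 0).

End Polynomials.

Section Triplets.
Variable R : realType.

Definition max_ratio (x y z : int) : \bar R :=
  if z == 0 then +oo%E
  else (Num.max `|x%:~R / z%:~R| `|y%:~R / z%:~R|)%:E.

Definition admissible (F : {mpoly rat[3]}) (delta : R) (x y z : int) : Prop :=
  [/\ (x, y, z) \notin [:: (0, 0, 0); (0, 0, 1); (0, 0, -1)],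
      gcdz x (gcdz y z) = 1,
      F.@[tnth [tuple x%:~R; y%:~R; z%:~R]] = 0 &
      (delta%:E <= max_ratio x y z)%E].

End Triplets.

(* Main.v *)
Require Import Defs.
From HB Require Import structures.
From mathcomp Require Import all_boot all_order all_algebra.
From mathcomp Require Import mpoly.
From mathcomp Require Import constructive_ereal reals exp.
From mathcomp Require Import boolp zify ring lra.

(** Write [g = gcd(x, y)], [x = g a], [y = g b], and let [H] be the largest of
    [|x|], [|y|], [|z|], and [M] the largest of [|x|], [|y|].  The condition
    [max(|x/z|, |y/z|) >= delta] keeps the point away from the origin for the
    real topology and makes [H] and [M] comparable.  On the blow-up of the curve
    at the origin, [log g] is the height attached to the exceptional divisor,
    of degree [m], and [log H] the height attached to a line section, of
    degree [d]; on a curve, heights are proportional to degrees up to an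
    arbitrarily small relative error, whence the exponent [m/d].  This
    proportionality is proved here with explicit auxiliary polynomials, whose
    existence follows from counting dimensions.

    Upper bound.  Modulo [f], the polynomials of degree at most [N] form a space
    of dimension [d N - O(1)], while vanishing to order [k] at the origin
    imposes only [m k + O(1)] conditions modulo [f].  So if [N/k] exceeds [m/d]
    slightly, there is [G] of degree at most [N], not divisible by [f], that is
    congruent modulo [f] to a polynomial of order at least [k]
    ([exists_high_order]).  At a point of the curve, the integer
    [z^N G(x/z, y/z)] is, up to a bounded factor, divisible by [g^k]; when it is
    not zero, [g^k <= C H^N] ([gcd_upper]).

    Lower bound.  It amounts to an upper bound for [max(|a|, |b|) = M/g].  When
    [N/k] exceeds [(d - m)/d] slightly, the same count provides [G0] and [G1] of
    degree at most [N], not both divisible by [f], with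
    [G0 y^k = G1 x^k] modulo [f] ([exists_proportional]).  At a point of the
    curve the coprime integers [a^k] and [b^k] are then proportional to two
    integers of size at most [C H^N] ([gcd_lower]).

    The points where an auxiliary polynomial vanishes form a finite set,
    because [f] is irreducible: by Gauss's lemma, [f] and a polynomial that it
    does not divide combine to a nonzero polynomial in one variable
    ([common_zeros_bounded]).  These points only affect the constants.

    Rational curves.  A birational map from the projective line presents all
    points outside a bounded set as values of three binary forms at coprime
    integers [(s, t)].  For forms without common factor the height of the value
    is a power of [h = max(|s|, |t|)] up to constants ([binary_height]).
    Applied to the three coordinates and to the first two, each time after
    removing the common factor, this gives [H ~ h^e2] and
    [max(|a|, |b|) ~ h^e1], hence [g ~ M^c] with [c = 1 - e1/e2].  There is
    no need to compute [e1] and [e2]: if [M] is unbounded, the first part of the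
    theorem forces [c = m/d] ([exponent_pinned]). *)

Set Implicit Arguments.
Unset Strict Implicit.
Unset Printing Implicit Defensive.

Import Order.TTheory GRing.Theory Num.Theory.
Local Open Scope ring_scope.

(** * Gauss's lemma for polynomials in two variables *)

Section Gauss.
Variable K : fieldType.
Implicit Types (c d e p : {poly K}) (f g h q : {poly {poly K}}).

Lemma irreducible_factor p : (1 < size p)%N ->
  exists2 c, irreducible_poly c & c %| p.
Proof.
have [n] := ubnP (size p); elim: n p => // n IHn p /ltnSE le_p_n p_gt1.
have [p_irr|p_red] := pselect (irreducible_poly p); first by exists p.
have: ~ (forall d, size d != 1%N -> d %| p -> d %= p) by move=> irr; apply: p_red.
case/existsNP=> d /not_implyP[d_neq1 /not_implyP[d_dvd_p d_neqp]].
have p_neq0 : p != 0 by rewrite -size_poly_gt0 (ltn_trans _ p_gt1).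
have d_neq0 : d != 0 by apply: contraNneq p_neq0 => q0; rewrite q0 dvd0p in d_dvd_p.
have d_gt1 : (1 < size d)%N by rewrite ltn_neqAle eq_sym d_neq1 size_poly_gt0.
have d_ltp : (size d < size p)%N.
  rewrite ltn_neqAle dvdp_leq // andbT; apply/negP => /eqP eq_size.
  by apply: d_neqp; rewrite -dvdp_size_eqp // eq_size.
have [c c_irr c_dvd_q] := IHn d (leq_trans d_ltp le_p_n) d_gt1.
by exists c => //; apply: dvdp_trans d_dvd_p.
Qed.

Lemma irreducible_poly_prime c p d : irreducible_poly c -> c %| p * d -> (c %| p) || (c %| d).
Proof.
move=> c_irr; have [//|c_ndvd_p] := boolP (c %| p).
by rewrite Gauss_dvdpr // irreducible_poly_coprime.
Qed.

(** If neither factor is divisible by [c], the product of their first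
    coefficients that [c] does not divide is, modulo [c], a coefficient of the
    product. *)
Lemma gauss_prime c f g h : irreducible_poly c -> c *: f = g * h ->
  (exists u, g = c *: u) \/ (exists u, h = c *: u).
Proof.
move=> c_irr fgh; have c_neq0 := irredp_neq0 c_irr.
have dvd_coef q : (forall i, c %| q`_i) -> exists u, q = c *: u.
  move=> c_dvd; exists (\poly_(i < size q) (q`_i %/ c)); apply/polyP=> i.
  rewrite coefZ coef_poly; case: ltnP => [_|le_q_i]; first by rewrite mulrC divpK.
  by rewrite mulr0 nth_default.
have first_coef q : ~ (forall i, c %| q`_i) ->
    exists i, ~~ (c %| q`_i) /\ forall j, (j < i)%N -> c %| q`_j.
  move=> /existsNP[i /negP ci]; have ex_i : exists i, ~~ (c %| q`_i) by exists i.
  case: (ex_minnP ex_i) => k ck k_min; exists k; split=> // j lt_jk.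
  by apply: contraLR lt_jk => /k_min; rewrite -leqNgt.
have [/dvd_coef|/first_coef[i [ci lt_i]]] := pselect (forall i, c %| g`_i); first by left.
have [/dvd_coef|/first_coef[j [cj lt_j]]] := pselect (forall i, c %| h`_i); first by right.
have: c %| (g * h)`_(i + j) by rewrite -fgh coefZ dvdp_mulr.
have lt_ij : (i < (i + j).+1)%N by rewrite ltnS leq_addr.
rewrite coefM (bigD1 (Ordinal lt_ij)) //= addKn dvdp_addl.
  by move=> /(irreducible_poly_prime c_irr); rewrite (negPf ci) (negPf cj).
apply: (big_ind (fun d => c %| d)) => [|p d|k]; [exact: dvdp0|exact: dvdp_add|].
rewrite -val_eqE /=; case: ltngtP => // [k_lt|k_gt] _.
  by rewrite dvdp_mulr // lt_i.
rewrite dvdp_mull // lt_j // ltn_subLR ?ltn_add2r //.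
by rewrite -ltnS ltn_ord.
Qed.

(** Induction on the number of irreducible factors, the form in which unique
    factorization is used to clear a scalar [c] from an identity [c *: f = g * h]. *)
Lemma irreducible_ind (P : {poly K} -> Prop) :
    (forall a, a != 0 -> P a%:P) ->
    (forall p e, irreducible_poly p -> P e -> P (p * e)) ->
  forall c, c != 0 -> P c.
Proof.
move=> Pconst Pmul c; have [n] := ubnP (size c).
elim: n c => // n IHn c /ltnSE le_c_n c_neq0.
have [c_gt1|c_le1] := ltnP 1 (size c); last first.
  have /size_poly1P[a a_neq0 ->] : size c == 1%N; last exact: Pconst.
  by rewrite eqn_leq c_le1 size_poly_gt0.
have [p p_irr /dvdpP[e def_c]] := irreducible_factor c_gt1.
have e_neq0 : e != 0 by apply: contraNneq c_neq0 => e0; rewrite def_c e0 mul0r.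
rewrite def_c mulrC; apply/Pmul/IHn => //; apply: leq_trans le_c_n.
rewrite def_c size_mul ?(irredp_neq0 p_irr) //.
by case: p_irr => p_gt1 _; rewrite -subn1 ltn_subRL add1n -[_.+1]addn1 ltn_add2l.
Qed.

Lemma scale_constK (a : K) f : a != 0 -> a^-1%:P *: (a%:P *: f) = f.
Proof. by move=> a_neq0; rewrite scalerA -polyCM mulVf // scale1r. Qed.

Lemma scale_polyI p f g : p != 0 -> p *: f = p *: g -> f = g.
Proof.
rewrite -!mul_polyC => p_neq0; apply: mulfI; by rewrite polyC_eq0.
Qed.

(** A factorization over the field of fractions descends to the polynomial ring
    with the same degrees: by [gauss_prime] each irreducible factor of the
    denominator [c] can be cancelled from one of the two factors. *)
Lemma gauss_factor c f g h : c != 0 -> c *: f = g * h ->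
  exists g1 h1, [/\ f = g1 * h1, size g1 = size g & size h1 = size h].
Proof.
move=> c_neq0; elim/irreducible_ind: c / c_neq0 g h => [a a_neq0|p e p_irr IHe] g h fgh.
  exists (a^-1%:P *: g), h; split=> //; last first.
    by rewrite size_scale // polyC_eq0 invr_eq0.
  by rewrite -scalerAl -fgh scale_constK.
have p_neq0 := irredp_neq0 p_irr; rewrite -scalerA in fgh.
case: (gauss_prime p_irr fgh) => [] [u def_u]; rewrite {}def_u in fgh *.
  case: (IHe u h) => [|g1 [h1 [? gu ?]]]; last by exists g1, h1; rewrite size_scale.
  by apply: (scale_polyI p_neq0); rewrite fgh scalerAl.
case: (IHe g u) => [|g1 [h1 [? gu ?]]]; last by exists g1, h1; rewrite size_scale.
by apply: (scale_polyI p_neq0); rewrite fgh scalerAr.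
Qed.

Lemma gauss_cancel c f g h : c != 0 ->
    (forall p u, irreducible_poly p -> f <> p *: u) ->
  c *: g = f * h -> exists u, g = f * u.
Proof.
move=> c_neq0 f_prim.
elim/irreducible_ind: c / c_neq0 h => [a a_neq0|p e p_irr IHe] h gfh.
  by exists (a^-1%:P *: h); rewrite -scalerAr -gfh scale_constK.
have p_neq0 := irredp_neq0 p_irr; rewrite -scalerA in gfh.
case: (gauss_prime p_irr gfh) => [] [u def_u]; first by case: (f_prim p u).
by apply: (IHe u); apply: (scale_polyI p_neq0); rewrite gfh def_u scalerAr.
Qed.

(** Over the fraction field of the coefficients, the greatest common divisor [h]
    of [f] and [g] is either a constant, and clearing denominators in its Bezout
    relation produces [r], or a nontrivial factor of [f].  In the second case
    Gauss's lemma makes [f] and [h] agree up to a scalar, so that [f] would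
    divide [g]. *)
Lemma irreducible_bezout f g :
    f != 0 -> (forall u v, f = u * v -> u \is a GRing.unit \/ v \is a GRing.unit) ->
    (forall u, g <> f * u) ->
  exists2 r : {poly K}, r != 0 & exists u v, r%:P = u * f + v * g.
Proof.
move=> f_neq0 f_irr f_ndvd.
have unit_size1 h : h \is a GRing.unit -> size h = 1%N.
  by rewrite poly_unitE => /andP[/eqP].
have [f_le1|f_gt1] := leqP (size f) 1.
  have [r def_f] : exists r, f = r%:P by exists f`_0; apply: size1_polyC.
  exists r; first by rewrite def_f polyC_eq0 in f_neq0.
  by exists 1, 0; rewrite mul1r mul0r addr0.
have [[u v] /= uv_gcd] := Bezoutp f g; set h := gcdp f g in uv_gcd.
have /Pdiv.Idomain.dvdpP[[c1 w] /= c1_neq0 uvh] : u * f + v * g %| h by rewrite (eqp_dvdl _ uv_gcd).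
have h_neq0 : h != 0 by rewrite gcdp_eq0 (negPf f_neq0).
have [h_le1|h_gt1] := leqP (size h) 1.
  have [r def_h] : exists r, h = r%:P by exists h`_0; apply: size1_polyC.
  have r_neq0 : r != 0 by rewrite def_h polyC_eq0 in h_neq0.
  exists (c1 * r); first by rewrite mulf_neq0.
  exists (w * u), (w * v); rewrite polyCM -def_h mul_polyC uvh mulrDr !mulrA //.
have /Pdiv.Idomain.dvdpP[[c2 q] /= c2_neq0 fqh] : h %| f by apply: dvdp_gcdl.
have /Pdiv.Idomain.dvdpP[[c3 t] /= c3_neq0 gth] : h %| g by apply: dvdp_gcdr.
have [q1 [h1 [f_qh q1q h1h]]] := gauss_factor c2_neq0 fqh.
have q1_size : size q1 = 1%N.
  case: (f_irr _ _ f_qh) => /unit_size1 // h1_1.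
  by rewrite -h1h h1_1 in h_gt1.
have [b def_q] : exists b, q = b%:P.
  by exists q`_0; apply: size1_polyC; rewrite -q1q q1_size.
have b_neq0 : b != 0.
  by apply: contra_eq_neq q1_size => b0; rewrite q1q def_q b0 size_poly0.
have : (c3 * b) *: g = f * (c2 *: t).
  by rewrite -scalerAr scalerAl fqh [c3 * b]mulrC -scalerA gth def_q -mul_polyC -mulrA [h * t]mulrC.
case/gauss_cancel; first by rewrite mulf_neq0.
  move=> p s p_irr f_ps.
  have [p_gt1 _] := p_irr.
  have := f_irr p%:P s; rewrite mul_polyC => /(_ f_ps)[|/unit_size1 s1].
    by rewrite poly_unitE coefC /= poly_unitE => /and3P[_ /eqP p1]; rewrite p1 in p_gt1.
  by move: f_gt1; rewrite f_ps size_scale ?s1 // irredp_neq0.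
by move=> s /f_ndvd.
Qed.

End Gauss.

(** * Common zeros of two plane curves *)

Section Bivariate.
Variables (K : fieldType) (i : 'I_2).

(** The isomorphism that singles out the variable of index [i]: it becomes the
    inner variable and the other one becomes the outer variable. *)
Definition to_poly2 : {mpoly K[2]} -> {poly {poly K}} :=
  mmap (polyC \o polyC) (fun k => if k == i then 'X%:P else 'X).

Definition of_poly2 : {poly {poly K}} -> {mpoly K[2]} :=
  horner_eval 'X_(rev_ord i) \o map_poly (horner_eval 'X_i \o map_poly (@mpolyC 2 K)).

HB.instance Definition _ := GRing.RMorphism.on to_poly2.
HB.instance Definition _ := GRing.RMorphism.on of_poly2.

Lemma of_poly2C r v : (of_poly2 r%:P).@[v] = r.[v i].
Proof.
rewrite /of_poly2 /= map_polyC /horner_eval /= hornerC.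
rewrite /horner_eval /=; elim/poly_ind: r => [|r c IHr]; first by rewrite rmorph0 !horner0 meval0.
by rewrite rmorphD rmorphM /= map_polyX map_polyC !hornerE mevalD mevalM IHr mevalXU mevalC.
Qed.

Lemma to_poly2X k : to_poly2 'X_k = if k == i then 'X%:P else 'X.
Proof. by rewrite /to_poly2 mmapX mmap1U. Qed.

Lemma of_poly2X : of_poly2 'X = 'X_(rev_ord i).
Proof. by rewrite /of_poly2 /= map_polyX /horner_eval hornerX. Qed.

Lemma of_poly2XC : of_poly2 'X%:P = 'X_i.
Proof.
by rewrite /of_poly2 /= map_polyC /horner_eval hornerC /= map_polyX /horner_eval hornerX.
Qed.

Lemma of_poly2CC c : of_poly2 c%:P%:P = c%:MP.
Proof.
by rewrite /of_poly2 /= map_polyC /horner_eval hornerC /= map_polyC /horner_eval hornerC.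
Qed.

Lemma rev_ord_neq : (rev_ord i == i) = false.
Proof. by case: i => [[|[]]]. Qed.

Lemma to_poly2K : cancel to_poly2 of_poly2.
Proof.
move=> g; rewrite {2}(mpolyE g) [in LHS](mpolyE g).
rewrite (rmorph_sum to_poly2) (rmorph_sum of_poly2); apply: eq_bigr => m _.
rewrite -mul_mpolyC !rmorphM /= {1}/to_poly2 mmapC of_poly2CC; congr (_ * _).
rewrite mpolyXE_id !rmorph_prod; apply: eq_bigr => k _; rewrite !rmorphXn /= to_poly2X.
case: eqP => [->|/eqP neq_ki]; first by rewrite of_poly2XC.
rewrite of_poly2X; congr ('X_ _ ^+ _); apply/val_inj.
by case: k i neq_ki => [[|[]] ?] // [[|[]] ?].
Qed.

Lemma of_poly2K : cancel of_poly2 to_poly2.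
Proof.
elim/poly_ind => [|g r IHg]; first by rewrite !rmorph0.
rewrite !rmorphD !rmorphM /= IHg of_poly2X to_poly2X rev_ord_neq; congr (_ + _).
elim/poly_ind: r => [|r c IHr]; first by rewrite !rmorph0.
rewrite !polyCD !polyCM !rmorphD !rmorphM /= IHr of_poly2XC to_poly2X eqxx; congr (_ + _).
by rewrite of_poly2CC /to_poly2 mmapC.
Qed.

(** The Bezout relation in [K['X_i][Y]] eliminates the other variable. *)
Lemma common_zero_root (f g : {mpoly K[2]}) :
    mirreducible f -> ~ principal_ideal f g ->
  exists2 r : {poly K}, r != 0 &
    forall v, f.@[v] = 0 -> g.@[v] = 0 -> root r (v i).
Proof.
move=> [f_neq0 f_nunit f_irr] f_ndvd.
have [|u v def_f|u def_g|r r_neq0 [u [v def_r]]] := @irreducible_bezout K (to_poly2 f) (to_poly2 g).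
- by rewrite -(rmorph0 to_poly2) (inj_eq (can_inj to_poly2K)).
- case: (f_irr (of_poly2 u) (of_poly2 v)); first by rewrite -rmorphM /= -def_f to_poly2K.
    by left; rewrite -[u]of_poly2K; apply: (rmorph_unit to_poly2).
  by right; rewrite -[v]of_poly2K; apply: (rmorph_unit to_poly2).
- by apply: f_ndvd; exists (of_poly2 u); rewrite -[f]to_poly2K -rmorphM /= -def_g to_poly2K.
exists r => // w f0 g0; rewrite rootE -of_poly2C def_r rmorphD !rmorphM /= !to_poly2K.
by rewrite mevalD !mevalM f0 g0 !mulr0 addr0.
Qed.

End Bivariate.

(** * Monomial bases and linear systems *)

Section Counting.
Variable K : fieldType.

(** More unknowns than linear conditions: some nontrivial combination of the
    [v i] has no monomial in [J]. *)
Lemma underdetermined n (I : finType) (v : I -> {mpoly K[n]}) (J : seq 'X_{1..n}) :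
    (size J < #|I|)%N ->
  exists2 c : I -> K, exists i, c i != 0 &
    forall a, a \in J -> (\sum_i c i *: v i)@_a = 0.
Proof.
move=> lt_JI.
pose A := \matrix_(i < #|I|, j < size J) (v (enum_val i))@_(nth 0%MM J j).
have /rowV0Pn[u /sub_kermxP uA0 u_neq0] : kermx A != 0.
  rewrite -mxrank_eq0 mxrank_ker -lt0n subn_gt0.
  exact: leq_ltn_trans (rank_leq_col _) lt_JI.
exists (fun i => u 0 (enum_rank i)).
  case/rV0Pn: u_neq0 => i ui; exists (enum_val i); by rewrite enum_valK.
move=> a aJ; have ltJ : (index a J < size J)%N by rewrite index_mem.
move/rowP/(_ (Ordinal ltJ)): uA0.
rewrite !mxE raddf_sum /= (reindex _ (onW_bij _ (enum_val_bij I))) => uA0 /=.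
rewrite -[RHS]uA0; apply: eq_bigr => i _.
by rewrite enum_valK mcoeffZ !mxE /= nth_index.
Qed.

Definition mcombo n (s : seq 'X_{1..n}) (c : 'I_(size s) -> K) : {mpoly K[n]} :=
  \sum_i c i *: 'X_[nth 0%MM s i].

Lemma mcombo_supp n (s : seq 'X_{1..n}) c a : a \in msupp (mcombo (s := s) c) -> a \in s.
Proof.
rewrite mcoeff_msupp; apply: contraR => a_notin; rewrite raddf_sum big1 // => i _ /=.
rewrite mcoeffZ mcoeffX; case: eqP => [def_a|]; last by rewrite mulr0.
by rewrite -def_a mem_nth in a_notin.
Qed.

Lemma mcombo_neq0 n (s : seq 'X_{1..n}) c i : uniq s -> c i != 0 -> mcombo (s := s) c != 0.
Proof.
move=> s_uniq; apply: contraNneq => c0; rewrite -(mcoeff0 _ (nth 0%MM s i)) -c0.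
rewrite raddf_sum (bigD1 i) //= mcoeffZ mcoeffX eqxx mulr1 big1 ?addr0 // => k neq_ki.
by rewrite mcoeffZ mcoeffX nth_uniq // (inj_eq val_inj) (negPf neq_ki) mulr0.
Qed.

Definition mon2 (a b : nat) : 'X_{1..2} := [multinom if i == ord0 then a else b | i < 2].

Lemma mon2_0 a b : mon2 a b ord0 = a. Proof. by rewrite mnmE. Qed.
Lemma mon2_1 a b : mon2 a b ord_max = b. Proof. by rewrite mnmE. Qed.

Lemma mdeg2 (a : 'X_{1..2}) : mdeg a = (a ord0 + a ord_max)%N.
Proof. by rewrite mdegE !big_ord_recl big_ord0 addn0; congr (_ + a _)%N; apply/val_inj. Qed.

Lemma mon2P (a b : 'X_{1..2}) : a ord0 = b ord0 -> a ord_max = b ord_max -> a = b.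
Proof.
move=> eq0 eq1; apply/mnmP=> i.
by have [->|->] : i = ord0 \/ i = ord_max
  by case: i => [[|[]] lt_i] //; [left|right]; apply/val_inj.
Qed.

Definition monomials (lo hi : nat) : seq 'X_{1..2} :=
  [seq mon2 t (D - t) | D <- index_iota lo hi, t <- iota 0 D.+1].

Lemma mem_monomials lo hi a : (a \in monomials lo hi) = (lo <= mdeg a < hi)%N.
Proof.
apply/allpairsPdep/idP => [[D [t [D_in t_in ->]]]|a_in].
  rewrite mdeg2 mon2_0 mon2_1; move: D_in t_in; rewrite mem_index_iota mem_iota; lia.
exists (mdeg a), (a ord0); rewrite mem_index_iota mem_iota; split=> //; first by rewrite mdeg2; lia.
by apply: mon2P; rewrite ?mon2_0 ?mon2_1 // mdeg2 addKn.
Qed.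

Lemma uniq_monomials lo hi : uniq (monomials lo hi).
Proof.
apply: allpairs_uniq_dep => [|D _|[D t] [D' t']]; rewrite ?iota_uniq //.
case/allpairsPdep => D1 [t1 [_ t1_in [-> eq_t]]]; rewrite {}eq_t.
case/allpairsPdep => D2 [t2 [_ t2_in [-> eq_t]]]; rewrite {}eq_t /=.
move: t1_in t2_in; rewrite !mem_iota => t1_le t2_le eq12.
have := mon2_0 t1 (D1 - t1); have := mon2_1 t1 (D1 - t1); rewrite eq12 mon2_0 mon2_1.
by move=> ? ?; have -> : t1 = t2 by []; have -> : D1 = D2 by lia.
Qed.

(** Twice the number of monomials, with the subtraction moved to the other side
    so that the identity holds in natural numbers. *)
Lemma size_monomials lo hi : (lo <= hi)%N ->
  (size (monomials lo hi) * 2 + lo * lo.+1 = hi * hi.+1)%N.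
Proof.
move=> le_lohi; rewrite size_allpairs_dep; under eq_map do rewrite size_iota.
rewrite -(subnKC le_lohi) /index_iota addKn; elim: (hi - lo)%N => [|n IHn].
  by rewrite addn0.
by rewrite -[n.+1]addn1 iotaD map_cat sumn_cat /=; nia.
Qed.

(** In each degree [D >= mdeg mu] exactly [mdeg mu] monomials are not multiples
    of [mu]: either the exponent [t] of the first variable is less than that of
    [mu], or the exponent of the second one is.  With [mu] the leading monomial
    of [f], no nonzero combination of them is a multiple of [f]. *)
Definition reduced_monomials (mu : 'X_{1..2}) (lo hi : nat) : seq 'X_{1..2} :=
  [seq (if (t < mu ord0)%N then mon2 t (D - t)
        else mon2 (D - (t - mu ord0)) (t - mu ord0))
    | D <- index_iota lo hi, t <- iota 0 (mdeg mu)].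

Lemma mem_reduced_monomials mu lo hi a : (mdeg mu <= lo)%N ->
  a \in reduced_monomials mu lo hi -> (lo <= mdeg a < hi)%N && ~~ (mu <= a)%MM.
Proof.
move=> le_mu_lo /allpairsPdep[D [t [D_in t_in ->]]].
move: D_in t_in; rewrite mem_index_iota mem_iota /= add0n => D_in t_in.
rewrite mdeg2 in le_mu_lo t_in; apply/andP; split.
  by case: ifP => ?; rewrite mdeg2 mon2_0 mon2_1; lia.
case: ifP => t_lt; apply/negP => /mnm_lepP.
  by move=> /(_ ord0); rewrite mon2_0; lia.
by move=> /(_ ord_max); rewrite mon2_1; lia.
Qed.

Lemma uniq_reduced_monomials mu lo hi : (mdeg mu <= lo)%N ->
  uniq (reduced_monomials mu lo hi).
Proof.
rewrite mdeg2 => le_mu_lo.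
apply: allpairs_uniq_dep => [|D _|[D t] [D' t']]; rewrite ?iota_uniq //.
case/allpairsPdep => D1 [t1 [D1_in t1_in [-> eq_t]]]; rewrite {}eq_t.
case/allpairsPdep => D2 [t2 [D2_in t2_in [-> eq_t]]]; rewrite {}eq_t /=.
move: D1_in D2_in t1_in t2_in; rewrite !mem_index_iota !mem_iota mdeg2 => ? ? ? ? eq12.
suff [-> ->] : t1 = t2 /\ D1 = D2 by [].
move: (congr1 (fun a : 'X_{1..2} => a ord0) eq12) (congr1 (fun a : 'X_{1..2} => a ord_max) eq12).
by case: ifP => ?; case: ifP => ?; rewrite !mon2_0 !mon2_1; lia.
Qed.

Lemma size_reduced_monomials mu lo hi :
  size (reduced_monomials mu lo hi) = ((hi - lo) * mdeg mu)%N.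
Proof.
rewrite size_allpairs_dep; under eq_map do rewrite size_iota.
rewrite -[in RHS](size_iota lo (hi - lo)) /index_iota.
by elim: (iota _ _) => //= D s ->; rewrite mulSn.
Qed.

Lemma msize_leP (n : nat) (g : {mpoly K[n]}) b :
  (forall a, a \in msupp g -> (mdeg a < b)%N) -> (msize g <= b)%N.
Proof. by rewrite msizeE => lt_b; apply/bigmax_leqP_seq => a /lt_b. Qed.

Lemma reduced_not_multiple n (f g : {mpoly K[n]}) : g != 0 ->
  (forall a, a \in msupp g -> ~~ (mlead f <= a)%MM) -> ~ principal_ideal f g.
Proof.
move=> g_neq0 g_red [h def_g]; have := g_red _ (mlead_supp g_neq0).
have [f_neq0 h_neq0] : f != 0 /\ h != 0.
  by apply/andP; rewrite -negb_or -mulf_eq0 -def_g.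
by rewrite def_g mleadM // lem_addr.
Qed.

(** The lowest monomials multiply, since the monomial order is compatible with
    products: the order of vanishing at the origin is additive. *)
Lemma mlastM n (f g : {mpoly K[n]}) : f != 0 -> g != 0 ->
  (mlast f + mlast g)%MM \in msupp (f * g).
Proof.
move=> f_neq0 g_neq0; rewrite mcoeff_msupp.
rewrite mpolyME (bigD1_seq (mlast f, mlast g)) /=; first last.
- by rewrite allpairs_uniq => // -[? ?] [].
- by rewrite allpairs_f // !mlast_supp.
rewrite mcoeffD mcoeffZ mcoeffX eqxx mulr1.
rewrite big_seq_cond raddf_sum /= big1 ?addr0.
  by rewrite mulf_neq0 // -mcoeff_msupp mlast_supp.
move=> _ /andP[/allpairsP[[a b] /= [/mlast_lemc le_fa /mlast_lemc le_gb ->]]].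
rewrite mcoeffZ mcoeffX /= xpair_eqE.
case: (_ =P (mlast f + mlast g)%MM) => [eq_ab|]; last by rewrite mulr0.
case/negP; move: le_fa; rewrite le_eqVlt => /predU1P[eq_fa|lt_fa].
  by rewrite -eq_fa eqxx /= -(eqm_add2l a) eq_ab eq_fa eqxx.
by have := ltmc_le_add lt_fa le_gb; rewrite -eq_ab ltxx.
Qed.

End Counting.

(** * Auxiliary polynomials *)

Section Auxiliary.
Variables (K : fieldType) (f : {mpoly K[2]}) (d m : nat).
Hypotheses (f_deg : has_degree f d) (f_ord : has_order f m).

Lemma has_degree_neq0 : f != 0.
Proof. by rewrite -msize_poly_eq0 f_deg. Qed.

Lemma mdeg_mlead : mdeg (mlead f) = d.
Proof. by apply: succn_inj; rewrite mlead_deg ?has_degree_neq0. Qed.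

Lemma mdeg_mlast : mdeg (mlast f) = m.
Proof.
have [[a af <-] min_f] := f_ord; apply/eqP; rewrite eqn_leq.
by rewrite (lemc_mdeg (mlast_lemc af)) min_f // mlast_supp // has_degree_neq0.
Qed.

Lemma order_le_degree : (m <= d)%N.
Proof. by have [[a af <-] _] := f_ord; rewrite -ltnS -f_deg msize_mdeg_lt. Qed.

Definition reduced lo hi := reduced_monomials (mlead f) lo hi.

Lemma reduced_mcombo_size hi c : (msize (@mcombo K _ (reduced d hi.+1) c) <= hi.+1)%N.
Proof.
apply: msize_leP => a /mcombo_supp /mem_reduced_monomials.
by rewrite mdeg_mlead => /(_ (leqnn _)) /andP[/andP[]].
Qed.

(** The leading monomial of a nonzero multiple of [f] is a multiple of that of
    [f]. *)
Lemma reduced_mcombo_ndvd hi c i : c i != 0 ->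
  ~ principal_ideal f (@mcombo K _ (reduced d hi) c).
Proof.
move=> ci; apply: reduced_not_multiple.
  by apply: mcombo_neq0 ci; apply: uniq_reduced_monomials; rewrite mdeg_mlead.
move=> a /mcombo_supp /mem_reduced_monomials.
by rewrite mdeg_mlead => /(_ (leqnn _)) /andP[].
Qed.

Lemma sum_mcombo n (s : seq 'X_{1..n}) (c F : 'I_(size s) -> K) (g : {mpoly K[n]})
    (G : 'I_(size s) -> {mpoly K[n]}) :
  (forall i, F i *: G i = g * (c i *: 'X_[nth 0%MM s i])) ->
  \sum_i F i *: G i = g * mcombo c.
Proof. by move=> FG; rewrite mulr_sumr; apply: eq_bigr => i _; rewrite FG. Qed.

(** The unknowns are the coefficients of [G] on reduced monomials of degrees [d]
    to [N = m j + d], that is [d (m j + 1)] of them, and those of [h] in degrees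
    less than [k - m], with [k = d j].  The equations say that [G - f h] has no
    term of degree less than [k].  Compared with the unknowns in [h] there are at
    most [m k] equations too many, and [m k < d (m j + 1)].  A nontrivial solution has [G <> 0], because
    [f h] has a term of degree less than [k] whenever [h] is not zero. *)
Lemma exists_high_order j : (0 < d)%N ->
  exists G h, [/\ (msize G <= (m * j + d).+1)%N, ~ principal_ideal f G &
    forall a, a \in msupp (G - f * h) -> (d * j <= mdeg a)%N].
Proof.
move=> d_gt0; set N := (m * j + d)%N; set k := (d * j)%N.
pose s1 := reduced d N.+1; pose s2 := monomials 0 (k - m).
pose v (i : 'I_(size s1) + 'I_(size s2)) := match i with
  | inl i => 'X_[nth 0%MM s1 i] : {mpoly K[2]}
  | inr i => - (f * 'X_[nth 0%MM s2 i]) end.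
have [|c [i ci] c0] := underdetermined v (J := monomials 0 k).
  rewrite card_sum !card_ord size_reduced_monomials mdeg_mlead.
  have := size_monomials (leq0n k); have := size_monomials (leq0n (k - m)).
  have -> : ((N.+1 - d) * d = m * k + d)%N by rewrite /N /k subSn ?leq_addl // addnK; lia.
  move: (size _) (size _) => t1 t2; clearbody k; have [le_mk|lt_km] := leqP m k; last by nia.
  by rewrite -(subnKC le_mk) addKn; nia.
pose G := mcombo (c \o inl : 'I_(size s1) -> K); pose h := mcombo (c \o inr : 'I_(size s2) -> K).
have sumE : \sum_i c i *: v i = G - f * h.
  rewrite big_sumType /= -(mul1r G) -mulNr; congr (_ + _); apply: sum_mcombo => l.
    by rewrite mul1r.
  by rewrite /= scalerN mulNr scalerAr.
have order_k a : a \in msupp (G - f * h) -> (k <= mdeg a)%N.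
  rewrite -sumE mcoeff_msupp; apply: contraR; rewrite -ltnNge => lt_ak.
  by rewrite c0 ?mem_monomials.
exists G, h; split=> //; first exact: reduced_mcombo_size.
(* If [G = 0], the lowest term of [f * h] has degree less than [k]. *)
suff [l cl] : exists l, c (inl l) != 0 by apply: reduced_mcombo_ndvd cl.
apply/existsP; apply: contraT => /existsPn cl0.
have G0 : G = 0 by rewrite /G /mcombo big1 // => l _ /=; rewrite (eqP (negbNE (cl0 l))) scale0r.
have h_neq0 : h != 0.
  case: i ci => [l|l] cl; first by have := cl0 l; rewrite cl.
  exact: (mcombo_neq0 (i := l) (uniq_monomials _ _)).
have := order_k (mlast f + mlast h)%MM; rewrite G0 sub0r (perm_mem (msuppN _)).
rewrite mlastM ?has_degree_neq0 // mdegD mdeg_mlast => /(_ isT).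
have := mlast_supp h_neq0 => /mcombo_supp; rewrite mem_monomials; lia.
Qed.

(** The unknowns are the coefficients of [G0] and [G1] on reduced monomials of
    degrees [d] to [N], and those of [h] in degrees [k - m] to [N + k - d], with
    [k = d j].  Both sides of the identity live in degrees [k] to [N + k], which
    leaves about [2 d N - (d (N + k) - m k) = d N - (d - m) k] free parameters;
    the term [3 d] in [N] makes this count positive. *)
Lemma exists_proportional j : (0 < j)%N -> (0 < d)%N ->
  let N := ((d - m) * j + 3 * d)%N in
  exists G0 G1 h, [/\ (msize G0 <= N.+1)%N, (msize G1 <= N.+1)%N,
    ~ principal_ideal f G0 \/ ~ principal_ideal f G1 &
    G0 * 'X_(ord_max) ^+ (d * j) - G1 * 'X_ord0 ^+ (d * j) = f * h].
Proof.
move=> j_gt0 d_gt0 N; set k := (d * j)%N.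
pose s1 := reduced d N.+1; pose s2 := monomials (k - m) (N + k - d).+1.
pose X0k := 'X_[mon2 k 0] : {mpoly K[2]}; pose X1k := 'X_[mon2 0 k] : {mpoly K[2]}.
have X0kE : X0k = 'X_ord0 ^+ k.
  rewrite mpolyXn; congr 'X_[_].
  by apply: mon2P; rewrite ?mon2_0 ?mon2_1 mulmnE mnm1E ?mul1n ?mul0n.
have X1kE : X1k = 'X_ord_max ^+ k.
  rewrite mpolyXn; congr 'X_[_].
  by apply: mon2P; rewrite ?mon2_0 ?mon2_1 mulmnE mnm1E ?mul1n ?mul0n.
pose v (i : 'I_(size s1) + 'I_(size s1) + 'I_(size s2)) := match i with
  | inl (inl i) => X1k * 'X_[nth 0%MM s1 i]
  | inl (inr i) => - (X0k * 'X_[nth 0%MM s1 i])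
  | inr i => - (f * 'X_[nth 0%MM s2 i]) end.
have le_md := order_le_degree.
have [|c [i ci] c0] := underdetermined v (J := monomials k (N + k).+1).
  rewrite !card_sum !card_ord size_reduced_monomials mdeg_mlead.
  have : (d * ((d - m) * j) = (d - m) * k)%N by rewrite /k mulnCA.
  rewrite /s2 /N; move: ((d - m) * j)%N => w dwE.
  have le_mk : (m <= k)%N by rewrite (leq_trans le_md) ?leq_pmulr.
  have [e def_d] : exists e, d = (m + e)%N by exists (d - m)%N; lia.
  have [k' def_k] : exists k', k = (m + k')%N by exists (k - m)%N; lia.
  have -> : ((w + 3 * d).+1 - d = w + 2 * d + 1)%N by lia.
  have -> : (w + 3 * d + k - d = w + 2 * d + k)%N by lia.
  have le1 : (k <= (w + 3 * d + k).+1)%N by lia.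
  have le2 : (k - m <= (w + 2 * d + k).+1)%N by lia.
  have := size_monomials le1; have := size_monomials le2.
  (* The unknowns exceed the equations by half of [3 d^2 + d - m^2 + m]. *)
  move: (size _) (size _) dwE => t1 t2; clearbody k; rewrite def_k def_d !addKn.
  by have := leq0n (m * m); have := leq0n (m * e); have := leq0n (e * e); lia.
pose G0 := mcombo (c \o inl \o inl : 'I_(size s1) -> K).
pose G1 := mcombo (c \o inl \o inr : 'I_(size s1) -> K).
pose h := mcombo (c \o inr : 'I_(size s2) -> K).
have sumE : \sum_i c i *: v i = G0 * X1k - G1 * X0k - f * h.
  rewrite !big_sumType /= [G0 * _]mulrC [G1 * _]mulrC -!mulNr.
  congr (_ + _ + _); apply: sum_mcombo => l /=; by rewrite ?scalerN ?mulNr scalerAr.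
have eq0 : G0 * X1k - G1 * X0k - f * h = 0.
  apply/mpolyP=> a; rewrite mcoeff0 -sumE.
  have [a_in|a_notin] := boolP (a \in monomials k (N + k).+1); first exact: c0.
  have supp (g : {mpoly K[2]}) (s : 'X_{1..2}) :
      (forall b, b \in msupp g -> (k <= mdeg b + mdeg s < (N + k).+1)%N) ->
      (g * 'X_[s])@_a = 0.
    move=> g_supp; apply/eqP; rewrite mcoeff_eq0; apply: contra a_notin.
    move/msuppM_le/allpairsP => [[b b'] /= [bg]]; rewrite msuppX inE => /eqP-> ->.
    by rewrite mem_monomials mdegD g_supp.
  rewrite raddf_sum big1 // => l _ /=; rewrite mcoeffZ.
  have bound i' : (i' < size s1)%N -> (mdeg (nth 0%MM s1 i') < N.+1)%N.
    move/(mem_nth 0%MM)/mem_reduced_monomials.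
    by rewrite mdeg_mlead => /(_ (leqnn _)) /andP[/andP[]].
  case: l => [[l|l]|l] /=; rewrite ?mcoeffN supp ?oppr0 ?mulr0 // => b.
  - rewrite msuppX inE => /eqP->; rewrite mdeg2 mon2_0 mon2_1; have := bound l (ltn_ord l); lia.
  - rewrite msuppX inE => /eqP->; rewrite mdeg2 mon2_0 mon2_1; have := bound l (ltn_ord l); lia.
  - move=> bf; have := (f_ord.2 _ bf); have := msize_mdeg_lt bf; rewrite f_deg.
    have : nth 0%MM s2 l \in s2 by apply: mem_nth.
    have : (d <= N)%N by rewrite (leq_trans _ (leq_addl _ _)) // leq_pmull.
    rewrite mem_monomials; move: (mdeg b) (mdeg (nth _ _ _)) => t t'; lia.
exists G0, G1, h; split.
- exact: reduced_mcombo_size.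
- exact: reduced_mcombo_size.
- suff [[l|l] cl] : exists l, c (inl l) != 0.
  - by left; apply: reduced_mcombo_ndvd cl.
  - by right; apply: reduced_mcombo_ndvd cl.
  apply/existsP; apply: contraT => /existsPn cl0.
  have G00 : G0 = 0.
    by rewrite /G0 /mcombo big1 // => l _ /=; rewrite (eqP (negbNE (cl0 _))) scale0r.
  have G10 : G1 = 0.
    by rewrite /G1 /mcombo big1 // => l _ /=; rewrite (eqP (negbNE (cl0 _))) scale0r.
  case: i ci => [l|l] cl; first by have := cl0 l; rewrite cl.
  have h_neq0 : h != 0 by apply: (mcombo_neq0 (i := l) (uniq_monomials _ _)).
  move/eqP: eq0; rewrite G00 G10 !mul0r subrr sub0r oppr_eq0 mulf_eq0.
  by rewrite (negPf has_degree_neq0) (negPf h_neq0).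
by apply/eqP; rewrite -subr_eq0 -X0kE -X1kE eq0.
Qed.

End Auxiliary.

(** * Integral values at rational points *)

Lemma dvdz_norm_le (a b : int) : (a %| b)%Z -> b != 0 -> `|a| <= `|b|.
Proof. by move=> a_dvd b_neq0; rewrite -!abszE lez_nat dvdn_leq // absz_gt0. Qed.

Lemma coprime3_bezout (x y z : int) : gcdz x (gcdz y z) = 1 ->
  exists u v w, u * x + v * y + w * z = 1.
Proof.
move=> <-; have [u [v <-]] := Bezoutz x (gcdz y z); have [s [t <-]] := Bezoutz y z.
by exists u, (v * s), (v * t); ring.
Qed.

(** Multiply a Bezout relation for [x], [y], [z] by [s]. *)
Lemma coprime3_dvd (x y z a : int) (s : int) : gcdz x (gcdz y z) = 1 ->
  (a %| s * x)%Z -> (a %| s * y)%Z -> (a %| s * z)%Z -> (a %| s)%Z.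
Proof.
move=> /coprime3_bezout[u [v [w uvw1]]] /dvdzP[x' ex] /dvdzP[y' ey] /dvdzP[z' ez].
apply/dvdzP; exists (u * x' + v * y' + w * z').
by rewrite -[LHS]mul1r -uvw1 !mulrDl -!mulrA ![_ * s]mulrC ex ey ez; ring.
Qed.

(** Since [x], [y], [z] have no common factor, [gcd(x, y)] is coprime to [z]. *)
Lemma gcd_split (x y z : int) : gcdz x (gcdz y z) = 1 -> (x, y) != (0, 0) ->
  exists a b, [/\ x = gcdz x y * a, y = gcdz x y * b, coprimez a b,
                  coprimez (gcdz x y) z & 0 < gcdz x y].
Proof.
move=> cop xy_neq0; set g := gcdz x y.
have g_gt0 : 0 < g.
  rewrite lt_neqAle eq_sym gcdz_eq0; apply/andP; split=> //.
have /dvdzP[a def_x] : (g %| x)%Z by apply: dvdz_gcdl.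
have /dvdzP[b def_y] : (g %| y)%Z by apply: dvdz_gcdr.
exists a, b; split; rewrite // 1?mulrC //; last by rewrite /coprimez -gcdzA cop.
apply/eqP/(mulfI (lt0r_neq0 g_gt0)); rewrite mulr1 -[X in X * _]gtz0_abs //.
by rewrite mulz_gcdr ![g * _]mulrC -def_x -def_y.
Qed.

Lemma common_denominator (s : seq rat) :
  exists2 D : int, 0 < D & forall q, q \in s -> D%:~R * q \is a Num.int.
Proof.
elim: s => [|q s [D D_gt0 Ds]]; first by exists 1.
exists (D * denq q); first by rewrite mulr_gt0 // denq_gt0.
move=> p; rewrite inE rmorphM /= => /predU1P[->|/Ds Dp].
  by rewrite -mulrA [_ * q]mulrC -numqE rpredM // rpred_int.
by rewrite mulrAC rpredM // rpred_int.
Qed.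

Lemma clear_denominators (I : eqType) (s : seq I) (q : I -> rat) :
  exists2 D : int, 0 < D & exists c : I -> int, {in s, forall i, D%:~R * q i = (c i)%:~R}.
Proof.
have [D D_gt0 Dq] := common_denominator (map q s); exists D => //.
exists (fun i => numq (D%:~R * q i)) => i i_s.
by rewrite [RHS]numqK // Dq // map_f.
Qed.

Lemma prod2 (R : comPzRingType) (v : 'I_2 -> R) (a : 'X_{1..2}) :
  \prod_i v i ^+ a i = v ord0 ^+ a ord0 * v ord_max ^+ a ord_max.
Proof.
rewrite !big_ord_recl big_ord0 mulr1; congr (_ * v _ ^+ a _); exact/val_inj.
Qed.

Definition point2 (R : Type) (X Y : R) (i : 'I_2) : R := if i == ord0 then X else Y.

Lemma le_monomial (x y z H : int) (i j k : nat) :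
  `|x| <= H -> `|y| <= H -> `|z| <= H -> `|x ^+ i * y ^+ j * z ^+ k| <= H ^+ (i + j + k).
Proof.
move=> xH yH zH; have H_ge0 : 0 <= H by apply: le_trans xH.
by rewrite !normrM !normrX !exprD !ler_pM ?mulr_ge0 ?exprn_ge0 // lerXn2r // nnegrE.
Qed.

(** The integer [n] is [D] times the homogenization of [G] in degree [N], taken
    at [(x, y, z)]; it is a sum of terms [c x^i y^j z^l] with [i + j + l = N], so
    it is at most [C H^N], and divisible by [g^k] if [i + j >= k] throughout. *)
Lemma integral_value (G : {mpoly rat[2]}) N : (msize G <= N.+1)%N ->
  exists D C : int, [/\ 0 < D, 0 < C & forall x y z : int, z != 0 ->
    exists n : int, [/\
      n%:~R = D%:~R * z%:~R ^+ N * G.@[point2 (x%:~R / z%:~R) (y%:~R / z%:~R)],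
      forall H, `|x| <= H -> `|y| <= H -> `|z| <= H -> `|n| <= C * H ^+ N &
      forall g k, (g %| x)%Z -> (g %| y)%Z ->
        (forall a, a \in msupp G -> (k <= mdeg a)%N) -> (g ^+ k %| n)%Z]].
Proof.
move=> G_deg; have [D D_gt0 [c Dc]] := clear_denominators (msupp G) (fun a => G@_a).
(* The summand [1] keeps the constant positive when [G = 0]. *)
exists D, (1 + \sum_(a <- msupp G) `|c a|); split=> //.
  by rewrite ltr_wpDr // sumr_ge0.
move=> x y z z_neq0.
exists (\sum_(a <- msupp G) c a * (x ^+ a ord0 * y ^+ a ord_max * z ^+ (N - mdeg a))).
split.
- rewrite rmorph_sum mevalE mulr_sumr big_seq [RHS]big_seq; apply: eq_bigr => a aG.
  rewrite rmorphM /= -Dc // -!mulrA; congr (_ * _); rewrite [RHS]mulrCA; congr (_ * _).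
  rewrite prod2 /point2 /= !rmorphM !rmorphXn /= !expr_div_n mdeg2.
  have := leq_trans (msize_mdeg_lt aG) G_deg; rewrite ltnS mdeg2 => le_aN.
  rewrite -{2}(subnKC le_aN) !exprD; field.
  by rewrite !expf_neq0 ?intr_eq0.
- move=> H xH yH zH; apply: le_trans (ler_norm_sum _ _ _) _.
  have H_ge1 : 1 <= H by apply: le_trans zH; rewrite -gtz0_ge1 normr_gt0.
  rewrite mulrDl mul1r -[leLHS]add0r lerD ?exprn_ge0 ?(le_trans _ H_ge1) //.
  rewrite mulr_suml big_seq [leRHS]big_seq; apply: ler_sum => a aG.
  rewrite normrM ler_wpM2l // (le_trans (le_monomial _ _ _ xH yH zH)) //.
  have := leq_trans (msize_mdeg_lt aG) G_deg; rewrite ltnS mdeg2 => le_aN.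
  by rewrite subnKC.
move=> g k gx gy Gk; rewrite big_seq; apply: (big_ind (fun n => g ^+ k %| n)%Z) => [|m n|a aG].
- exact: dvdz0.
- exact: rpredD.
rewrite dvdz_mull // dvdz_mulr //; apply: (@dvdz_trans (g ^+ mdeg a)).
  by rewrite dvdz_exp2l ?Gk.
by rewrite mdeg2 exprD dvdz_mul // dvdz_exp2r.
Qed.

(** * Bounds for the gcd on affine points *)

(** Induction on the degree, splitting off one root at a time. *)
Lemma finitely_many_roots (K : fieldType) (r : {poly K}) : r != 0 ->
  exists s : seq K, forall q, root r q -> q \in s.
Proof.
have [n] := ubnP (size r); elim: n r => // n IHn r /ltnSE le_rn r_neq0.
have [[a /factor_theorem[p def_r]]|no_root] := pselect (exists a, root r a); last first.
  by exists [::] => q rq; case: no_root; exists q.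
have p_neq0 : p != 0 by apply: contraNneq r_neq0 => p0; rewrite def_r p0 mul0r.
have [|s s_roots] := IHn p _ p_neq0.
  by apply: leq_trans le_rn; rewrite def_r size_Mmonic ?monicXsubC // size_XsubC addn2.
exists (a :: s) => q; rewrite def_r rootM root_XsubC inE orbC.
by case/orP=> [->|/s_roots->] //; rewrite orbT.
Qed.

Lemma root_height_bound (r : {poly rat}) : r != 0 ->
  exists2 B : int, 0 < B & forall q, root r q -> `|numq q| <= B /\ denq q <= B.
Proof.
move=> /finitely_many_roots[s s_roots].
have [B B_gt0 sB] : exists2 B : int, 0 < B &
    forall q, q \in s -> `|numq q| <= B /\ denq q <= B.
  elim: s {s_roots} => [|q s [B B_gt0 sB]]; first by exists 1.
  exists (B + `|numq q| + denq q); first by rewrite ltr_wpDr ?ltW ?denq_gt0 ?ltr_wpDr.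
  have := denq_gt0 q; have := normr_ge0 (numq q).
  by move=> n0 d0 p; rewrite inE => /predU1P[->|/sB[]]; lia.
by exists B => // q /s_roots /sB.
Qed.

Lemma fraction_bound (x z B : int) : z != 0 -> `|numq (x%:~R / z%:~R)| <= B ->
    denq (x%:~R / z%:~R) <= B ->
  exists2 D : int, [/\ 0 < D, D <= B & (z %| D * x)%Z] & `|x| <= B * `|z|.
Proof.
move=> z_neq0; set q := x%:~R / z%:~R => num_le den_le.
have eq_xz : denq q * x = numq q * z.
  apply/eqP; rewrite -(eqr_int rat) !rmorphM /= numqE /q.
  by apply/eqP; field; rewrite intr_eq0.
exists (denq q); first by rewrite denq_gt0 eq_xz dvdz_mull.
have := congr1 Num.norm eq_xz; rewrite !normrM normr_denq => eq_n.
apply: (le_trans (y := denq q * `|x|)).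
  by rewrite -[leLHS]mul1r ler_wpM2r // -gtz0_ge1 denq_gt0.
by rewrite eq_n ler_wpM2r.
Qed.

(** Both [x/z] and [y/z] are roots of fixed nonzero polynomials, hence belong to
    finite sets.  As [x], [y], [z] are coprime, [z] divides the product of the
    denominators of these two fractions. *)
Lemma common_zeros_bounded (f g : {mpoly rat[2]}) :
    mirreducible f -> ~ principal_ideal f g ->
  exists2 B : int, 0 < B & forall x y z : int, z != 0 -> gcdz x (gcdz y z) = 1 ->
    f.@[point2 (x%:~R / z%:~R) (y%:~R / z%:~R)] = 0 ->
    g.@[point2 (x%:~R / z%:~R) (y%:~R / z%:~R)] = 0 ->
    [/\ `|x| <= B, `|y| <= B & `|z| <= B].
Proof.
move=> f_irr f_ndvd.
have [r0 /root_height_bound[B0 B0_gt0 r0_B] r0_root] := common_zero_root ord0 f_irr f_ndvd.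
have [r1 /root_height_bound[B1 B1_gt0 r1_B] r1_root] := common_zero_root ord_max f_irr f_ndvd.
pose B := B0 + B1.
have B_ge1 : 1 <= B by rewrite /B; lia.
exists (B ^+ 3); first by rewrite exprn_gt0 // (lt_le_trans _ B_ge1).
move=> x y z z_neq0 cop f0 g0.
have [num0 den0] := r0_B _ (r0_root _ f0 g0); have [num1 den1] := r1_B _ (r1_root _ f0 g0).
have [D0 [D0_gt0 D0_le z_x] x_le] := fraction_bound z_neq0 num0 den0.
have [D1 [D1_gt0 D1_le z_y] y_le] := fraction_bound z_neq0 num1 den1.
have z_dvd : (z %| D0 * D1)%Z.
  apply: (coprime3_dvd cop); last exact: dvdz_mull.
    by rewrite mulrAC dvdz_mulr.
  by rewrite -mulrA dvdz_mull.
have z_le : `|z| <= B ^+ 2.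
  apply: le_trans (dvdz_norm_le z_dvd _) _; first by rewrite mulf_neq0 ?lt0r_neq0.
  by rewrite normrM !gtr0_norm // expr2 ler_pM // /B; lia.
have B_ge0 : 0 <= B by rewrite (le_trans _ B_ge1).
split; last by rewrite (le_trans z_le) // [leRHS]exprS ler_peMl ?exprn_ge0.
  by rewrite (le_trans x_le) // exprS ler_pM // /B; lia.
by rewrite (le_trans y_le) // exprS ler_pM // /B; lia.
Qed.

(** Coprimality makes [s^k] divide [D n].  If [n = 0] then [s = 0], as [n] and
    [p] do not both vanish. *)
Lemma proportional_power_le (s t D E n p : int) k :
    coprimez s t -> 0 < D -> 0 < E -> (0 < k)%N -> ~ (n = 0 /\ p = 0) ->
  D * n * t ^+ k = E * p * s ^+ k -> `|s| ^+ k <= D * `|n|.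
Proof.
move=> cop_st D_gt0 E_gt0 k_gt0 np_neq0 eq_np; have [n0|n_neq0] := eqVneq n 0.
  have -> : s = 0; last by rewrite normr0 expr0n gtn_eqF // mulr_ge0 // ltW.
  have /esym/eqP := eq_np; rewrite n0 mulr0 mul0r !mulf_eq0 expf_eq0 k_gt0 /=.
  by rewrite (negPf (lt0r_neq0 E_gt0)) => /orP[/eqP p0|/eqP//]; case: np_neq0.
have : (s ^+ k %| D * n)%Z.
  rewrite -(Gauss_dvdzl (m := s ^+ k) _ (p := t ^+ k)); last by apply/coprimezXl/coprimezXr.
  by rewrite eq_np dvdz_mull.
move/dvdz_norm_le; rewrite mulf_neq0 ?(lt0r_neq0 D_gt0) // => /(_ isT).
by rewrite normrX normrM (gtr0_norm D_gt0).
Qed.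

Lemma meval_varX n (R : comNzRingType) (v : 'I_n -> R) i k : ('X_i ^+ k).@[v] = v i ^+ k.
Proof. by rewrite rmorphXn /= mevalXU. Qed.

Lemma proportional_value (K : fieldType) (f g0 g1 h : {mpoly K[2]}) k X Y :
    g0 * 'X_ord_max ^+ k - g1 * 'X_ord0 ^+ k = f * h -> f.@[point2 X Y] = 0 ->
  g0.@[point2 X Y] * Y ^+ k = g1.@[point2 X Y] * X ^+ k.
Proof.
move=> /(congr1 (meval (point2 X Y))) eq_g f0; apply/eqP; rewrite -subr_eq0.
rewrite -(meval_varX (point2 X Y) ord_max) -(meval_varX (point2 X Y) ord0).
by rewrite -!mevalM -mevalB eq_g mevalM f0 mul0r.
Qed.

Section CurvePoints.
Variables (f : {mpoly rat[2]}) (d m : nat).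
Hypotheses (f_irr : mirreducible f) (f_deg : has_degree f d) (f_ord : has_order f m).

Lemma irreducible_degree_gt0 : (0 < d)%N.
Proof.
have [f_neq0 f_nunit _] := f_irr; rewrite lt0n; apply: contraNneq f_nunit => d0.
have /eqP := f_deg; rewrite d0 => /msize_poly1P[c c_neq0 ->].
by apply: (rmorph_unit (@mpolyC 2 rat)); rewrite unitfE.
Qed.

(** Points of the curve outside the line at infinity, in coprime homogeneous
    coordinates bounded by [H]. *)
Definition curve_point (x y z H : int) : Prop :=
  [/\ gcdz x (gcdz y z) = 1, f.@[point2 (x%:~R / z%:~R) (y%:~R / z%:~R)] = 0,
      z != 0, (x, y) != (0, 0) & [/\ `|x| <= H, `|y| <= H & `|z| <= H]].

Lemma curve_point_ge1 x y z H : curve_point x y z H -> 1 <= H.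
Proof.
by case=> _ _ z_neq0 _ [_ _ /(le_trans _)]; apply; rewrite -gtz0_ge1 normr_gt0.
Qed.

(** At a zero of [f] the polynomials [G] and [G - f h] of [exists_high_order]
    take the same value: the first has degree at most [N] and bounds the integer
    [z^N G(x/z, y/z)], the second has order at least [k] and makes [g^k] divide
    it up to powers of [z], which are coprime to [g].  At the bounded set of
    zeros of [G] the bound holds with the constant [B^k]. *)
Lemma gcd_upper j :
  exists2 C : int, 0 < C & forall x y z H, curve_point x y z H ->
    gcdz x y ^+ (d * j) <= C * H ^+ (m * j + d).
Proof.
have [G [h [G_deg G_ndvd R_ord]]] := exists_high_order f_deg f_ord j irreducible_degree_gt0.
set k := (d * j)%N; set N := (m * j + d)%N.
have [D1 [C1 [D1_gt0 C1_gt0 G_val]]] := integral_value G_deg.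
have [D2 [C2 [D2_gt0 C2_gt0 R_val]]] := integral_value (leqnSn (msize (G - f * h))).
have [B B_gt0 zeros_B] := common_zeros_bounded f_irr G_ndvd.
exists (D2 * C1 + B ^+ k); first by rewrite addr_gt0 ?mulr_gt0 ?exprn_gt0.
move=> x y z H xyzH; have H_ge1 := curve_point_ge1 xyzH.
have H_ge0 : 0 <= H by apply: le_trans H_ge1.
case: xyzH => cop f0 z_neq0 xy_neq0 [xH yH zH].
have [a [b [def_x def_y _ cop_gz g_gt0]]] := gcd_split cop xy_neq0.
set g := gcdz x y in def_x def_y cop_gz g_gt0 *.
rewrite mulrDl.
have [G0|G_neq0] := eqVneq (G.@[point2 (x%:~R / z%:~R) (y%:~R / z%:~R)]) 0.
  have [xB yB _] := zeros_B x y z z_neq0 cop f0 G0.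
  rewrite -[leLHS]add0r lerD ?mulr_ge0 ?exprn_ge0 ?(ltW D2_gt0) ?(ltW C1_gt0) //.
  apply: (@le_trans _ _ (B ^+ k)); last by rewrite ler_peMr ?exprn_ge0 ?exprn_ege1 ?(ltW B_gt0).
  rewrite lerXn2r ?nnegrE ?(ltW g_gt0) ?(ltW B_gt0) //.
  case: (eqVneq x 0) => [x0|x_neq0].
    have y_neq0 : y != 0 by apply: contraNneq xy_neq0 => y0; rewrite x0 y0.
    by rewrite (le_trans _ yB) // -[leLHS]gtr0_norm // dvdz_norm_le // dvdz_gcdr.
  by rewrite (le_trans _ xB) // -[leLHS]gtr0_norm // dvdz_norm_le // dvdz_gcdl.
have [n1 [n1E n1_le _]] := G_val x y z z_neq0.
have [n2 [n2E _ /(_ g k (dvdz_gcdl _ _) (dvdz_gcdr _ _) R_ord) g_n2]] := R_val x y z z_neq0.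
have z_rat : z%:~R != 0 :> rat by rewrite intr_eq0.
have n1_neq0 : n1 != 0.
  rewrite -(intr_eq0 rat) n1E !mulf_neq0 ?expf_neq0 ?intr_eq0 //; exact: lt0r_neq0.
(* [G] and [G - f * h] take the same value at a zero of [f]. *)
have eq_n : D1 * z ^+ N * n2 = z ^+ (msize (G - f * h)) * (D2 * n1).
  apply/eqP; rewrite -(eqr_int rat) !rmorphM !rmorphXn /= n1E n2E.
  rewrite mevalB mevalM f0 mul0r subr0; apply/eqP.
  by move: (z%:~R ^+ _) (z%:~R ^+ N) (G.@[_]) => u v w; ring.
have g_n1 : (g ^+ k %| D2 * n1)%Z.
  rewrite -(Gauss_dvdzr _ (m := g ^+ k) (n := z ^+ (msize (G - f * h)))).
    by rewrite -eq_n dvdz_mull.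
  by apply/coprimezXl/coprimezXr.
rewrite -[leLHS]addr0 lerD ?mulr_ge0 ?exprn_ge0 ?(ltW B_gt0) //.
have := dvdz_norm_le g_n1; rewrite mulf_neq0 ?(lt0r_neq0 D2_gt0) // => /(_ isT).
rewrite normrX gtr0_norm // normrM gtr0_norm // => /le_trans; apply.
by rewrite -mulrA ler_wpM2l ?(ltW D2_gt0) // n1_le.
Qed.

(** With [x = g a] and [y = g b], the relation of [exists_proportional] becomes
    [G0 b^k = G1 a^k] at the point, so [|a|^k] and [|b|^k] are at most the
    integral values of [G0] and [G1], unless both vanish. *)
Lemma gcd_lower j : (0 < j)%N ->
  exists2 C : int, 0 < C & forall x y z H, curve_point x y z H ->
    let bound := C * H ^+ ((d - m) * j + 3 * d) * gcdz x y ^+ (d * j) in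
    `|x| ^+ (d * j) <= bound /\ `|y| ^+ (d * j) <= bound.
Proof.
move=> j_gt0; have d_gt0 := irreducible_degree_gt0.
have [G0 [G1 [h [G0_deg G1_deg G_ndvd eq_G]]]] := exists_proportional f_deg f_ord j_gt0 d_gt0.
set k := (d * j)%N in eq_G *; set N := ((d - m) * j + 3 * d)%N in G0_deg G1_deg *.
have k_gt0 : (0 < k)%N by rewrite muln_gt0 d_gt0.
have [D0 [C0 [D0_gt0 C0_gt0 G0_val]]] := integral_value G0_deg.
have [D1 [C1 [D1_gt0 C1_gt0 G1_val]]] := integral_value G1_deg.
have [B B_gt0 zeros_B] : exists2 B : int, 0 < B & forall x y z : int, z != 0 ->
    gcdz x (gcdz y z) = 1 ->
    f.@[point2 (x%:~R / z%:~R) (y%:~R / z%:~R)] = 0 ->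
    G0.@[point2 (x%:~R / z%:~R) (y%:~R / z%:~R)] = 0 ->
    G1.@[point2 (x%:~R / z%:~R) (y%:~R / z%:~R)] = 0 -> `|x| <= B /\ `|y| <= B.
  case: G_ndvd => /(common_zeros_bounded f_irr)[B B_gt0 zeros_B];
    exists B => // x y z z0 cop f0 G00 G10.
    by have [] := zeros_B x y z z0 cop f0 G00.
  by have [] := zeros_B x y z z0 cop f0 G10.
exists (B ^+ k + D1 * C0 + D0 * C1).
  by rewrite !addr_gt0 ?mulr_gt0 ?exprn_gt0.
move=> x y z H xyzH; have H_ge1 := curve_point_ge1 xyzH.
have H_ge0 : 0 <= H by apply: le_trans H_ge1.
case: xyzH => cop f0 z_neq0 xy_neq0 [xH yH zH].
have [a [b [def_x def_y cop_ab _ g_gt0]]] := gcd_split cop xy_neq0.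
set g := gcdz x y in def_x def_y g_gt0 *.
suff [a_le b_le] : `|a| ^+ k <= (B ^+ k + D1 * C0 + D0 * C1) * H ^+ N /\
                   `|b| ^+ k <= (B ^+ k + D1 * C0 + D0 * C1) * H ^+ N.
  rewrite def_x def_y !normrM (gtr0_norm g_gt0) !exprMn ![g ^+ k * _]mulrC.
  by split; apply: ler_wpM2r; rewrite ?exprn_ge0 ?(ltW g_gt0).
have [n0 [n0E n0_le _]] := G0_val x y z z_neq0.
have [n1 [n1E n1_le _]] := G1_val x y z z_neq0.
have z_rat : z%:~R != 0 :> rat by rewrite intr_eq0.
have eq_n : D1 * n0 * b ^+ k = D0 * n1 * a ^+ k.
  apply/(mulIf (expf_neq0 k (lt0r_neq0 g_gt0))).
  rewrite -!mulrA -!exprMn ![_ * g]mulrC -def_x -def_y.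
  apply/eqP; rewrite -(eqr_int rat) !rmorphM !rmorphXn /= n0E n1E; apply/eqP.
  have := proportional_value eq_G f0; rewrite !expr_div_n.
  set u := G0.@[_]; set v := G1.@[_] => uv.
  have zk : z%:~R ^+ k != 0 :> rat by rewrite expf_neq0.
  have uv' : u * y%:~R ^+ k = v * x%:~R ^+ k.
    by apply: (mulIf (invr_neq0 zk)); rewrite -!mulrA uv.
  by rewrite -!mulrA uv' mulrCA.
have [[n00 n10]|n_neq0] := pselect (n0 = 0 /\ n1 = 0); last first.
  have HN_ge0 : 0 <= H ^+ N by rewrite exprn_ge0.
  have B_ge0 : 0 <= B ^+ k * H ^+ N by rewrite mulr_ge0 ?exprn_ge0 ?ltW.
  have b0 : D1 * `|n0| <= D1 * C0 * H ^+ N by rewrite -mulrA ler_wpM2l ?(ltW D1_gt0) ?n0_le //.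
  have b1 : D0 * `|n1| <= D0 * C1 * H ^+ N by rewrite -mulrA ler_wpM2l ?(ltW D0_gt0) ?n1_le //.
  have b0_ge0 : 0 <= D1 * `|n0| by rewrite mulr_ge0 ?(ltW D1_gt0).
  have b1_ge0 : 0 <= D0 * `|n1| by rewrite mulr_ge0 ?(ltW D0_gt0).
  have := proportional_power_le cop_ab D1_gt0 D0_gt0 k_gt0 n_neq0 eq_n.
  have n_neq0' : ~ (n1 = 0 /\ n0 = 0) by case=> *; apply: n_neq0.
  have := proportional_power_le _ D0_gt0 D1_gt0 k_gt0 n_neq0' (esym eq_n).
  rewrite coprimez_sym => /(_ cop_ab) b_le a_le; rewrite !mulrDl.
  have c0_ge0 := le_trans b0_ge0 b0; have c1_ge0 := le_trans b1_ge0 b1.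
  split; first by rewrite (le_trans a_le) // (le_trans b0) // -addrA addrCA lerDl addr_ge0.
  by rewrite (le_trans b_le) // (le_trans b1) // lerDr addr_ge0.
have value0 D n (g1 : {mpoly rat[2]}) : 0 < D -> n = 0 ->
    n%:~R = D%:~R * z%:~R ^+ N * g1.@[point2 (x%:~R / z%:~R) (y%:~R / z%:~R)] ->
    g1.@[point2 (x%:~R / z%:~R) (y%:~R / z%:~R)] = 0.
  move=> D_gt0 -> /esym /eqP; rewrite !mulf_eq0 expf_eq0 (negPf z_rat) andbF intr_eq0.
  by rewrite (negPf (lt0r_neq0 D_gt0)) => /eqP.
have G00 := value0 _ _ _ D0_gt0 n00 n0E; have G10 := value0 _ _ _ D1_gt0 n10 n1E.
have [xB yB] := zeros_B x y z z_neq0 cop f0 G00 G10.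
have le_g s : `|s| <= `|g * s|.
  by rewrite normrM ler_peMl // gtr0_norm // -gtz0_ge1.
have le_B s : `|s| <= B -> `|s| ^+ k <= (B ^+ k + D1 * C0 + D0 * C1) * H ^+ N.
  move=> sB; rewrite -addrA mulrDl -[leLHS]addr0 lerD //; last first.
    by rewrite mulr_ge0 ?exprn_ge0 // addr_ge0 ?mulr_ge0 ?ltW.
  apply: (@le_trans _ _ (B ^+ k)); first by rewrite lerXn2r ?nnegrE // ltW.
  by rewrite ler_peMr ?exprn_ge0 ?exprn_ege1 // ltW.
by split; apply: le_B; apply: le_trans (le_g _) _; rewrite -?def_x -?def_y.
Qed.

End CurvePoints.

(** * Binary forms and their common factors *)

Section BinaryForms.
Implicit Types (P Q : {poly rat}) (e : nat) (s t : rat).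

(** The binary form of degree [e] whose dehomogenization is [P]; the factor
    [t^(e - deg P)] is part of the form, so [e] cannot be read off [P]. *)
Definition bform e P s t : rat := \sum_(i < e.+1) P`_i * s ^+ i * t ^+ (e - i).

Definition reverse_poly e P : {poly rat} := \poly_(i < e.+1) P`_(e - i).

Lemma bform_horner e P s t : (size P <= e.+1)%N -> t != 0 ->
  bform e P s t = t ^+ e * P.[s / t].
Proof.
move=> P_size t_neq0; rewrite (horner_coef_wide _ P_size) mulr_sumr; apply: eq_bigr => i _.
have le_ie : (i <= e)%N by rewrite -ltnS.
by rewrite expr_div_n -[X in t ^+ X * _](subnK le_ie) exprD; field; rewrite expf_neq0.
Qed.

Lemma bform_at0 e P s : bform e P s 0 = P`_e * s ^+ e.
Proof.
rewrite /bform big_ord_recr /= subnn mulr1 big1 ?add0r // => i _.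
by rewrite expr0n subn_eq0 leqNgt ltn_ord mulr0.
Qed.

(** For [t <> 0] both sides are [t^(e1 + e2) (P Q)(s/t)]; for [t = 0] only the
    coefficients of top degree survive. *)
Lemma bformM e1 e2 P Q s t : (size P <= e1.+1)%N -> (size Q <= e2.+1)%N ->
  bform (e1 + e2) (P * Q) s t = bform e1 P s t * bform e2 Q s t.
Proof.
move=> P_size Q_size; have PQ_size : (size (P * Q)%R <= (e1 + e2).+1)%N.
  by apply: leq_trans (size_polyMleq P Q) _; lia.
have [->|t_neq0] := eqVneq t 0; last first.
  by rewrite !bform_horner // hornerM exprD; ring.
have lt1 : (e1 < (e1 + e2).+1)%N by rewrite ltnS leq_addr.
rewrite !bform_at0 coefM (bigD1 (Ordinal lt1)) //= addKn big1 ?addr0.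
  by rewrite exprD; ring.
move=> i; rewrite -val_eqE /=; case: ltngtP => // [lt_i|gt_i] _.
  by rewrite [Q`__]nth_default ?mulr0 // (leq_trans Q_size) //; lia.
by rewrite [P`__]nth_default ?mul0r // (leq_trans P_size).
Qed.

Lemma bform1 e s t : bform e 1 s t = t ^+ e.
Proof.
rewrite /bform big_ord_recl coefC /= mul1r expr0 mul1r subn0 big1 ?addr0 // => i _.
by rewrite coefC /= !mul0r.
Qed.

Lemma bform0 e s t : bform e 0 s t = 0.
Proof. by rewrite /bform big1 // => i _; rewrite coef0 !mul0r. Qed.

Lemma bform_sum e (I : finType) (P : I -> {poly rat}) s t :
  bform e (\sum_i P i) s t = \sum_i bform e (P i) s t.
Proof.
rewrite /bform exchange_big; apply: eq_bigr => k _ /=.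
by rewrite coef_sum !mulr_suml.
Qed.

Lemma size_reverse_poly e P : (size (reverse_poly e P) <= e.+1)%N.
Proof. exact: size_poly. Qed.

Lemma reverse_polyK e P : (size P <= e.+1)%N -> reverse_poly e (reverse_poly e P) = P.
Proof.
move=> P_size; apply/polyP=> i; rewrite coef_poly; case: ltnP => [lt_i|le_i].
  by rewrite coef_poly ltnS leq_subr subKn.
by rewrite nth_default // (leq_trans P_size).
Qed.

Lemma bform_reverse_poly e P s t : bform e (reverse_poly e P) s t = bform e P t s.
Proof.
rewrite [RHS](reindex_inj rev_ord_inj); apply: eq_bigr => i _ /=.
by rewrite coef_poly ltn_ord subSS subKn 1?mulrAC // -ltnS.
Qed.

Lemma family_bezout (K : fieldType) r (P : 'I_r -> {poly K}) :
  exists D A, D = \sum_i A i * P i /\ forall i, D %| P i.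
Proof.
elim: r P => [|r IHr] P; first by exists 0, (fun=> 0); rewrite big_ord0; split=> // -[].
have [D [A [def_D D_dvd]]] := IHr (fun i => P (lift ord0 i)).
have [[u v] /= uv_gcd] := Bezoutp (P ord0) D.
exists (u * P ord0 + v * D).
exists (fun i => if unlift ord0 i is Some j then v * A j else u); split.
  rewrite big_ord_recl unlift_none; congr (_ + _); rewrite {1}def_D mulr_sumr.
  by apply: eq_bigr => i _; rewrite liftK mulrA.
move=> i; rewrite (eqp_dvdl _ uv_gcd); case: (unliftP ord0 i) => [j ->|->].
  exact: dvdp_trans (dvdp_gcdr _ _) (D_dvd j).
exact: dvdp_gcdl.
Qed.

(** The forms have no common zero on the projective line.  One Bezout relation
    is given in each of the two affine charts, because the first one alone does
    not exclude the common zero [t = 0]. *)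
Definition base_point_free r e (Q : 'I_r -> {poly rat}) : Prop :=
  [/\ forall i, (size (Q i) <= e.+1)%N,
      exists A, \sum_i A i * Q i = 1 & exists B, \sum_i B i * reverse_poly e (Q i) = 1].

Lemma family_split (r e : nat) (P : 'I_r -> {poly rat}) :
    (forall i, (size (P i) <= e.+1)%N) -> (exists i, P i != 0) ->
  (exists A, \sum_i A i * P i = 1) \/
  exists (e1 e2 : nat) (D : {poly rat}) (P1 : 'I_r -> {poly rat}),
  [/\ (e = e1.+1 + e2)%N, (size D <= e1.+2)%N,
    forall i, (size (P1 i) <= e2.+1)%N & forall i, P i = D * P1 i].
Proof.
move=> P_size [i0 Pi0]; have [D [A [def_D D_dvd]]] := family_bezout P.
have D_neq0 : D != 0 by apply: contraNneq Pi0 => D0; rewrite -dvd0p -D0.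
have [D_gt1|D_le1] := ltnP 1 (size D); [right | left].
  have PE i : P i = D * (P i %/ D) by rewrite mulrC divpK.
  have lt_De : (size D <= e.+1)%N by rewrite (leq_trans (dvdp_leq Pi0 (D_dvd i0))).
  exists (size D).-2, (e - (size D).-1)%N, D, (fun i => P i %/ D); split=> //.
  - by move: D_gt1 lt_De; case: (size D) => [|[|n]] //= _ le_ne; lia.
  - by move: D_gt1; case: (size D) => [|[]].
  move=> i; rewrite size_divp // -subSn ?leq_sub2r //.
  by rewrite -subn1 leq_subLR add1n.
have /size_poly1P[a a_neq0 def_a] : size D == 1%N by rewrite eqn_leq D_le1 size_poly_gt0.
exists (fun i => a^-1%:P * A i); under eq_bigr do rewrite -mulrA.
by rewrite -mulr_sumr -def_D def_a -polyCM mulVf.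
Qed.

(** Induction on the degree: a common factor is removed in one of the two charts
    until there is none left in either. *)
Lemma remove_base_points r e (P : 'I_r -> {poly rat}) :
    (forall i, (size (P i) <= e.+1)%N) -> (exists i, P i != 0) ->
  exists e' (Q : 'I_r -> {poly rat}) (w : rat -> rat -> rat), base_point_free e' Q /\
    forall i s t, bform e (P i) s t = w s t * bform e' (Q i) s t.
Proof.
have [n] := ubnP e; elim: n e P => // n IHn e P /ltnSE le_en P_size P_neq0.
have [A_P|[e1 [e2 [D [P1 [def_e D_size P1_size PE]]]]]] := family_split P_size P_neq0; last first.
  have [||e' [Q [w [Q_bpf P1E]]]] := IHn e2 P1 _ P1_size; first by lia.
    by have [i Pi] := P_neq0; exists i; apply: contraNneq Pi => P10; rewrite PE P10 mulr0.
  exists e', Q, (fun s t => bform e1.+1 D s t * w s t); split=> // i s t.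
  by rewrite def_e PE bformM // P1E mulrA.
have prev_neq0 : exists i, reverse_poly e (P i) != 0.
  have [i Pi] := P_neq0; exists i; apply: contraNneq Pi => Pi0.
  rewrite -(reverse_polyK (P_size i)) Pi0; apply/eqP/polyP=> k.
  by rewrite coef_poly !coef0 if_same.
have [B_P|[e1 [e2 [D [P1 [def_e D_size P1_size PE]]]]]] :=
  family_split (fun i => size_reverse_poly e (P i)) prev_neq0.
  by exists e, P, (fun _ _ => 1); split=> // i s t; rewrite mul1r.
have [||e' [Q [w [Q_bpf P1E]]]] := IHn e2 (fun i => reverse_poly e2 (P1 i)) _ (fun i => size_reverse_poly _ _).
- by lia.
- have [i Pi] := prev_neq0; exists i; apply: contraNneq Pi => P10; rewrite PE.
  rewrite -(reverse_polyK (P1_size i)) P10; apply/eqP; rewrite -[RHS](mulr0 D); congr (_ * _).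
  by apply/polyP=> k; rewrite coef_poly !coef0 if_same.
exists e', Q, (fun s t => bform e1.+1 D t s * w s t); split=> // i s t.
by rewrite -bform_reverse_poly PE def_e bformM // -[bform e2 _ t s]bform_reverse_poly P1E mulrA.
Qed.

(** Homogenization of the Bezout relation: the ideal of the forms contains a
    power of [t]. *)
Lemma bform_bezout r e (A Q : 'I_r -> {poly rat}) :
    (forall i, (size (Q i) <= e.+1)%N) -> \sum_i A i * Q i = 1 ->
  exists K, forall s t, \sum_i bform K (A i) s t * bform e (Q i) s t = t ^+ (K + e).
Proof.
move=> Q_size AQ1; exists (\max_i size (A i))%N => s t.
rewrite -(bform1 _ s t) -AQ1 bform_sum; apply: eq_bigr => i _; rewrite bformM //.
exact/leqW/leq_bigmax.
Qed.

Lemma integral_bforms r e (P : 'I_r -> {poly rat}) :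
  exists D C : int, [/\ 0 < D, 0 < C & forall s t : int, exists n : 'I_r -> int, forall i,
    (n i)%:~R = D%:~R * bform e (P i) s%:~R t%:~R /\
    forall h, `|s| <= h -> `|t| <= h -> `|n i| <= C * h ^+ e].
Proof.
have [D D_gt0 [c Dc]] :=
  clear_denominators (enum {: 'I_r * 'I_e.+1}) (fun ik => (P ik.1)`_ik.2).
exists D, (1 + \sum_i \sum_k `|c (i, k)|); split=> //.
  by rewrite ltr_wpDr // sumr_ge0 // => i _; rewrite sumr_ge0.
move=> s t; exists (fun i => \sum_(k < e.+1) c (i, k) * (s ^+ k * t ^+ (e - k))) => i; split.
  rewrite rmorph_sum mulr_sumr; apply: eq_bigr => k _.
  by rewrite !rmorphM !rmorphXn /= -Dc ?mem_enum // !mulrA.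
move=> h sh th; apply: le_trans (ler_norm_sum _ _ _) _.
have h_ge0 : 0 <= h by apply: le_trans sh.
apply: (@le_trans _ _ ((\sum_k `|c (i, k)|) * h ^+ e)); last first.
  rewrite ler_wpM2r ?exprn_ge0 // [X in 1 + X](bigD1 i) //= addrCA lerDl.
  rewrite addr_ge0 // sumr_ge0 // => j _.
  by rewrite sumr_ge0.
rewrite mulr_suml; apply: ler_sum => k _; rewrite normrM ler_wpM2l //.
rewrite normrM !normrX -[X in h ^+ X](subnKC (ltnSE (ltn_ord k))) exprD.
by rewrite ler_pM ?exprn_ge0 // lerXn2r // nnegrE.
Qed.

End BinaryForms.

(** * Heights under maps of the projective line *)

Lemma integral_bezout r e (A Q : 'I_r -> {poly rat}) (D : int) : 0 < D ->
    (forall i, (size (Q i) <= e.+1)%N) -> \sum_i A i * Q i = 1 ->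
  exists (K : nat) (E C : int), [/\ 0 < E, 0 < C & forall (s t : int) (n : 'I_r -> int),
    (forall i, (n i)%:~R = D%:~R * bform e (Q i) s%:~R t%:~R) ->
    exists a : 'I_r -> int, \sum_i a i * n i = E * t ^+ (K + e) /\
      forall h i, `|s| <= h -> `|t| <= h -> `|a i| <= C * h ^+ K].
Proof.
move=> D_gt0 Q_size AQ1; have [K AQK] := bform_bezout Q_size AQ1.
have [D' [C [D'_gt0 C_gt0 A_int]]] := integral_bforms K A.
exists K, (D' * D), C; split=> [||s t n nE]; rewrite ?mulr_gt0 //.
have [a a_prop] := A_int s t; exists a; split; last first.
  by move=> h i; have [_ a_le] := a_prop i; apply: a_le.
apply/eqP; rewrite -(eqr_int rat) rmorph_sum !rmorphM rmorphXn /= -(AQK s%:~R) mulr_sumr.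
apply/eqP/eq_bigr => i _; rewrite rmorphM /= nE; have [-> _] := a_prop i.
by rewrite mulrACA.
Qed.

Lemma dvd_coprime_powers (a E s t : int) k l : coprimez s t ->
  (a %| E * s ^+ k)%Z -> (a %| E * t ^+ l)%Z -> (a %| E)%Z.
Proof.
move=> cop /dvdzP[u us] /dvdzP[v vt].
have /coprimezP[[p q] /= pq1] : coprimez (s ^+ k) (t ^+ l) by apply/coprimezXl/coprimezXr.
apply/dvdzP; exists (p * u + q * v).
by rewrite -[LHS]mulr1 -pq1 mulrDr ![E * (_ * _)]mulrCA us vt mulrDl !mulrA.
Qed.

(** The values at [(s, t)] are [mu X i] for an integer [mu], up to a fixed
    denominator.  The Bezout relations express powers of [s] and of [t] by these
    values.  Since [s] and [t] are coprime, this bounds [mu], so no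
    cancellation occurs; and it prevents all values from being much smaller
    than [h^e]. *)
Lemma binary_height r e (Q : 'I_r -> {poly rat}) : base_point_free e Q ->
  exists2 C : int, 0 < C &
    forall (s t h : int) (X : 'I_r -> int) (lambda : rat),
      coprimez s t -> h = Num.max `|s| `|t| -> (exists w, \sum_i w i * X i = 1) ->
      (forall i, bform e (Q i) s%:~R t%:~R = lambda * (X i)%:~R) ->
      (forall i, `|X i| <= C * h ^+ e) /\ h ^+ e <= C * \sum_i `|X i|.
Proof.
move=> [Q_size [A AQ1] [B BQ1]]; have [D [C [D_gt0 C_gt0 Q_int]]] := integral_bforms e Q.
have [K1 [E1 [C1 [E1_gt0 C1_gt0 bez1]]]] := integral_bezout D_gt0 Q_size AQ1.
have [K2 [E2 [C2 [E2_gt0 C2_gt0 bez2]]]] := integral_bezout D_gt0 (fun i => size_reverse_poly _ _) BQ1.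
exists (C + E1 * E2 * (C1 + C2)); first by rewrite !(addr_gt0, mulr_gt0).
move=> s t h X lambda cop def_h [w wX1] QX.
have [sh th] : `|s| <= h /\ `|t| <= h by rewrite def_h !le_max !lexx orbT.
have h_gt0 : 0 < h.
  rewrite lt_neqAle (le_trans (normr_ge0 s) sh) andbT eq_sym; apply: contraTneq cop => h0.
  move: sh th; rewrite h0 !normr_le0 => /eqP-> /eqP->.
  by rewrite /coprimez gcdz0.
have [n n_prop] := Q_int s t.
have nE i : (n i)%:~R = D%:~R * bform e (Q i) s%:~R t%:~R by have [] := n_prop i.
have nE' i : (n i)%:~R = D%:~R * bform e (reverse_poly e (Q i)) t%:~R s%:~R by rewrite bform_reverse_poly nE.
have [a1 [bez1E a1_le]] := bez1 s t n nE; have [a2 [bez2E a2_le]] := bez2 t s n nE'.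
(* The Bezout relation of the [X i] makes the factor of proportionality an integer. *)
pose mu := \sum_i w i * n i.
have n_mu i : n i = mu * X i.
  apply/eqP; rewrite -(eqr_int rat) rmorphM rmorph_sum /= nE QX mulrA; apply/eqP; congr (_ * _).
  have wX1' : (\sum_i w i * X i)%:~R = 1 :> rat by rewrite wX1.
  rewrite -[LHS]mulr1 -[X in _ * X = _]wX1' rmorph_sum /= mulr_sumr.
  by apply: eq_bigr => k _; rewrite !rmorphM /= nE QX; ring.
have mu_neq0 : mu != 0.
  apply/eqP=> mu0; have n0 i : n i = 0 by rewrite n_mu mu0 mul0r.
  have sum0 (a : 'I_r -> int) : \sum_i a i * n i = 0.
    by rewrite big1 // => i _; rewrite n0 mulr0.
  have root0 (E v : int) k : 0 < E -> 0 = E * v ^+ k -> v = 0.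
    move=> E_gt0 /esym/eqP; rewrite mulf_eq0 (negPf (lt0r_neq0 E_gt0)) expf_eq0.
    by case/andP=> _ /eqP.
  have s0 : s = 0 by apply: (root0 E2 s (K2 + e)%N); rewrite // -bez2E.
  have t0 : t = 0 by apply: (root0 E1 t (K1 + e)%N); rewrite // -bez1E.
  by move: cop; rewrite s0 t0 /coprimez gcdz0.
have mu_dvd : (mu %| E1 * E2)%Z.
  have mu_sum (b : 'I_r -> int) : (mu %| \sum_i b i * n i)%Z.
    by apply: rpred_sum => i _; rewrite n_mu mulrCA dvdz_mulr.
  apply: (dvd_coprime_powers (k := K2 + e) (l := K1 + e) cop).
    by rewrite -mulrA -bez2E dvdz_mull.
  by rewrite mulrAC -bez1E dvdz_mulr.
have mu_le : `|mu| <= E1 * E2.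
  have := dvdz_norm_le mu_dvd; rewrite mulf_neq0 ?lt0r_neq0 // => /(_ isT).
  by rewrite [`|E1 * _|]normrM (gtr0_norm E1_gt0) (gtr0_norm E2_gt0).
have E_ge0 : 0 <= E1 * E2 by rewrite mulr_ge0 ?(ltW E1_gt0) ?(ltW E2_gt0).
have he_ge0 k : 0 <= h ^+ k by rewrite exprn_ge0 // ltW.
have SX_ge0 : 0 <= \sum_i `|X i| by apply: sumr_ge0.
split=> [i|].
  have [_ n_le] := n_prop i; rewrite mulrDl -[leLHS]addr0 lerD //; last first.
    by rewrite mulr_ge0 ?he_ge0 // mulr_ge0 // addr_ge0 ?(ltW C1_gt0) ?(ltW C2_gt0).
  apply: le_trans (n_le _ sh th); rewrite n_mu normrM ler_peMl //.
  by rewrite -gtz0_ge1 normr_gt0.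
have lower K E' C' (a : 'I_r -> int) (v : int) : 0 < E' -> 0 < C' -> h = `|v| ->
    \sum_i a i * n i = E' * v ^+ (K + e) -> (forall i, `|a i| <= C' * h ^+ K) ->
    h ^+ e <= E1 * E2 * C' * \sum_i `|X i|.
  move=> E'_gt0 C'_gt0 hv bezE a_le.
  rewrite -(ler_pM2l (exprn_gt0 K h_gt0)) -exprD.
  apply: (@le_trans _ _ (E' * h ^+ (K + e))); first by rewrite ler_peMl // -gtz0_ge1.
  rewrite {1}hv -normrX -(gtr0_norm E'_gt0) -normrM -bezE.
  apply: le_trans (ler_norm_sum _ _ _) _.
  have -> : h ^+ K * (E1 * E2 * C' * \sum_i `|X i|) = \sum_i (C' * h ^+ K) * (E1 * E2 * `|X i|).
    by rewrite -mulr_sumr -mulr_sumr; ring.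
  by apply: ler_sum => i _; rewrite normrM ler_pM // n_mu normrM ler_wpM2r.
have a1_le' i : `|a1 i| <= C1 * h ^+ K1 by apply: a1_le.
have a2_le' i : `|a2 i| <= C2 * h ^+ K2 by apply: a2_le.
have weaken C' : 0 <= C' -> C' <= C1 + C2 ->
    E1 * E2 * C' * \sum_i `|X i| <= (C + E1 * E2 * (C1 + C2)) * \sum_i `|X i|.
  move=> C'_ge0 le_C'; rewrite ler_wpM2r // -[leLHS]add0r lerD ?(ltW C_gt0) //.
  by rewrite ler_wpM2l.
have [le_st|lt_ts] := leP `|s| `|t|.
  have ht : h = `|t| by rewrite def_h; apply/max_idPr.
  apply: le_trans (lower _ _ _ _ _ E1_gt0 C1_gt0 ht bez1E a1_le') _.
  by rewrite weaken ?(ltW C1_gt0) // lerDl ltW.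
have hs : h = `|s| by rewrite def_h; apply/max_idPl/ltW.
apply: le_trans (lower _ _ _ _ _ E2_gt0 C2_gt0 hs bez2E a2_le') _.
by rewrite weaken ?(ltW C2_gt0) // lerDr ltW.
Qed.

(** The pair [(0, 0)] is allowed, with [kappa = 0]: this covers constant
    parametrizations. *)
Lemma coprime_direction (v0 v1 : rat) :
  exists (s t : int) (kappa : rat), [/\ coprimez s t, v0 = kappa * s%:~R & v1 = kappa * t%:~R].
Proof.
have [v_eq0|v_neq0] := eqVneq (v0, v1) (0, 0).
  by case: v_eq0 => -> ->; exists 1, 0, 0; rewrite !mul0r.
have [D D_gt0 Dv] := common_denominator [:: v0; v1].
have /intrP[a def_a] : D%:~R * v0 \is a Num.int by rewrite Dv // inE eqxx.
have /intrP[b def_b] : D%:~R * v1 \is a Num.int by rewrite Dv // !inE eqxx orbT.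
have D_neq0 : D%:~R != 0 :> rat by rewrite intr_eq0 lt0r_neq0.
have ab_neq0 : (a, b) != (0, 0).
  apply: contraNneq v_neq0 => -[a0 b0]; move/eqP: def_a; move/eqP: def_b.
  by rewrite a0 b0 !mulf_eq0 (negPf D_neq0) /= => /eqP-> /eqP->.
have [||s [t [def_s def_t cop _ g_gt0]]] := @gcd_split a b 1.
- by rewrite gcdz1 gcdz1.
- by [].
exists s, t, ((gcdz a b)%:~R / D%:~R); split=> //; apply: (mulfI D_neq0).
  by rewrite def_a {1}def_s rmorphM /=; field.
by rewrite def_b {1}def_t rmorphM /=; field.
Qed.

Lemma bform_scale e P kappa s t :
  bform e P (kappa * s) (kappa * t) = kappa ^+ e * bform e P s t.
Proof.
rewrite mulr_sumr; apply: eq_bigr => i _.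
by rewrite -[in kappa ^+ e](subnKC (ltnSE (ltn_ord i))) exprD !exprMn; ring.
Qed.

Definition binary_dehomogenize e (G : {mpoly rat[2]}) : {poly rat} :=
  \poly_(k < e.+1) G@_(mon2 k (e - k)).

Lemma bform_homog (G : {mpoly rat[2]}) e v : G \is e.-homog ->
  G.@[v] = bform e (binary_dehomogenize e G) (v ord0) (v ord_max).
Proof.
move=> G_homog; have GE : G = \sum_(k < e.+1) G@_(mon2 k (e - k)) *: 'X_[mon2 k (e - k)].
  apply/mpolyP=> a; rewrite raddf_sum /=.
  have [deg_a|deg_a] := eqVneq (mdeg a) e; last first.
    rewrite (dhomog_nemf_coeff G_homog deg_a) big1 // => k _.
    rewrite mcoeffZ mcoeffX; case: eqP => [def_a|]; last by rewrite mulr0.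
    by move: deg_a; rewrite -def_a mdeg2 mon2_0 mon2_1 subnKC ?eqxx // -ltnS.
  have a0_lt : (a ord0 < e.+1)%N by rewrite ltnS -deg_a mdeg2 leq_addr.
  rewrite (bigD1 (Ordinal a0_lt)) //= mcoeffZ mcoeffX.
  have -> : mon2 (a ord0) (e - a ord0) = a.
    by apply: mon2P; rewrite ?mon2_0 ?mon2_1 // -deg_a mdeg2 addKn.
  rewrite eqxx mulr1 big1 ?addr0 // => k neq_k; rewrite mcoeffZ mcoeffX.
  case: eqP => [def_a|]; last by rewrite mulr0.
  by case/eqP: neq_k; apply: val_inj; rewrite /= -def_a mon2_0.
rewrite {1}GE raddf_sum; apply: eq_bigr => k _ /=.
by rewrite mevalZ mevalX prod2 mon2_0 mon2_1 coef_poly ltn_ord mulrA.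
Qed.

(** * Homogenization *)

Section Homogenization.
Variable K : fieldType.
Implicit Types (f g h : {mpoly K[2]}) (W : {mpoly K[3]}).

Definition point3 (x y z : K) : 'I_3 -> K := tnth [tuple x; y; z].
Definition ord3_0 : 'I_3 := ord0.
Definition ord3_1 : 'I_3 := @Ordinal 3 1 isT.
Definition ord3_2 : 'I_3 := ord_max.

Lemma pt3_scale (c x y z : K) : point3 (c * x) (c * y) (c * z) =1 fun i => c * point3 x y z i.
Proof. by case=> [[|[|[]]]]. Qed.

Lemma meval_homog_scale n (W : {mpoly K[n]}) N (c : K) v : W \is N.-homog ->
  W.@[fun i => c * v i] = c ^+ N * W.@[v].
Proof.
move=> W_homog; rewrite !mevalE mulr_sumr big_seq [RHS]big_seq; apply: eq_bigr => a aW.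
rewrite mulrCA -(dhomog_mf W_homog aW) /= mdegE -prodrXr -big_split /=.
by congr (_ * _); apply: eq_bigr => i _; rewrite exprMn.
Qed.

Definition dehomogenize W : {mpoly K[2]} := W \mPo [tuple 'X_0; 'X_1; 1].

Lemma dehomogenize_eval W x y : (dehomogenize W).@[point2 x y] = W.@[point3 x y 1].
Proof.
rewrite /dehomogenize comp_mpoly_meval; apply: meval_eq => -[[|[|[]]] //= lt_i].
- by rewrite (_ : Ordinal lt_i = ord0) ?mevalXU //; apply: val_inj.
- by rewrite (_ : Ordinal lt_i = ord3_1) ?mevalXU //; apply: val_inj.
- by rewrite (_ : Ordinal lt_i = ord3_2) ?rmorph1 //; apply: val_inj.
Qed.

Lemma homogeneous_eval W N (x y z : K) : z != 0 -> W \is N.-homog ->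
  W.@[point3 x y z] = z ^+ N * (dehomogenize W).@[point2 (x / z) (y / z)].
Proof.
move=> z_neq0 W_homog; rewrite dehomogenize_eval -(meval_homog_scale _ _ W_homog).
apply: meval_eq => i; rewrite -pt3_scale; congr (point3 _ _ _ i); by field.
Qed.

Lemma dehomogenize_mon (m : 'X_{1..3}) :
  dehomogenize 'X_[m] = 'X_[mon2 (m ord3_0) (m ord3_1)].
Proof.
rewrite /dehomogenize comp_mpolyX [RHS]mpolyXE_id !big_ord_recl !big_ord0 !mulr1 /=.
rewrite !mnmE /= expr1n mulr1.
by congr (_ * _); congr ('X_ _ ^+ m _); apply: val_inj.
Qed.

Lemma dehomogenizeE W :
  dehomogenize W = \sum_(a <- msupp W) W@_a *: 'X_[mon2 (a ord3_0) (a ord3_1)].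
Proof.
by rewrite /dehomogenize comp_mpolyEX; apply: eq_bigr => a _; rewrite -dehomogenize_mon.
Qed.

Lemma dehomogenize_coeff W N (m : 'X_{1..3}) : W \is N.-homog -> mdeg m = N ->
  (dehomogenize W)@_(mon2 (m ord3_0) (m ord3_1)) = W@_m.
Proof.
move=> W_homog deg_m; have deg3 (a : 'X_{1..3}) : mdeg a = (a ord3_0 + a ord3_1 + a ord3_2)%N.
  rewrite mdegE !big_ord_recl big_ord0 addn0 addnA.
  by congr (_ + _ + _)%N; congr (a _); apply: val_inj.
rewrite dehomogenizeE raddf_sum /=.
have term (a : 'X_{1..3}) : a \in msupp W ->
    (W@_a *: 'X_[mon2 (a ord3_0) (a ord3_1)])@_(mon2 (m ord3_0) (m ord3_1)) = W@_a * (a == m)%:R.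
  move=> aW; rewrite mcoeffZ mcoeffX; congr (_ * (nat_of_bool _)%:R).
  apply/eqP/eqP => [eq_am|->//]; apply/mnmP.
  have e0 : a ord3_0 = m ord3_0 by rewrite -(mon2_0 (a ord3_0) (a ord3_1)) eq_am mon2_0.
  have e1 : a ord3_1 = m ord3_1 by rewrite -(mon2_1 (a ord3_0) (a ord3_1)) eq_am mon2_1.
  have e2 : a ord3_2 = m ord3_2.
    by have := dhomog_mf W_homog aW; rewrite /= -deg_m !deg3 e0 e1 => /addnI.
  by case=> [[|[|[]]] //= lt_i]; [move: e0|move: e1|move: e2];
    congr (_ = _); congr (_ _); apply: val_inj.
rewrite big_seq (eq_bigr _ term) -big_seq.
have [mW|m_notin] := boolP (m \in msupp W).
  rewrite (bigD1_seq m) ?msupp_uniq //= eqxx mulr1 big1 ?addr0 // => a /negPf->.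
  by rewrite mulr0.
rewrite memN_msupp_eq0 // big_seq big1 // => a aW; case: eqP => [def_a|]; last by rewrite mulr0.
by rewrite -def_a aW in m_notin.
Qed.

(** A form of known degree is determined by its dehomogenization, because the
    exponent of the last variable is determined by the two others. *)
Lemma dehomogenize_inj W1 W2 N : W1 \is N.-homog -> W2 \is N.-homog ->
  dehomogenize W1 = dehomogenize W2 -> W1 = W2.
Proof.
move=> W1_homog W2_homog eqW; apply/mpolyP=> m.
have [deg_m|deg_m] := eqVneq (mdeg m) N.
  by rewrite -(dehomogenize_coeff W1_homog deg_m) eqW (dehomogenize_coeff W2_homog deg_m).
by rewrite (dhomog_nemf_coeff W1_homog deg_m) (dhomog_nemf_coeff W2_homog deg_m).
Qed.

Lemma dehomogenize_msize W N : W \is N.-homog -> (msize (dehomogenize W) <= N.+1)%N.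
Proof.
move=> W_homog; rewrite dehomogenizeE big_seq.
apply: (big_ind (fun g => msize g <= N.+1)%N) => [|g h gN hN|a aW]; first by rewrite msize0.
  by apply: leq_trans (msizeD_le _ _) _; rewrite geq_max gN.
apply: leq_trans (msizeZ_le _ _) _.
rewrite msizeX ltnS mdeg2 mon2_0 mon2_1 -(dhomog_mf W_homog aW) /= mdegE !big_ord_recl big_ord0.
rewrite addnA (_ : lift ord0 ord0 = ord3_1) ?leq_addr //; exact: val_inj.
Qed.

(** Both [W] and the homogenization of [f h], completed by a power of the last
    variable, are forms of degree [N] with the same dehomogenization. *)
Lemma dehomogenize_multiple f W N : f != 0 -> W \is N.-homog ->
  principal_ideal f (dehomogenize W) -> principal_ideal (homogenize f) W.
Proof.
move=> f_neq0 W_homog [h def_W]; have [h0|h_neq0] := eqVneq h 0.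
  exists 0; apply: (dehomogenize_inj W_homog); first by rewrite mulr0 dhomog0.
  by rewrite def_W h0 !mulr0 /dehomogenize raddf0.
pose df := (msize f).-1; pose dh := (msize h).-1.
have le_N : (df + dh <= N)%N.
  have := dehomogenize_msize W_homog; rewrite def_W msizeM // /df /dh.
  by rewrite (mpolySpred _ f_neq0) (mpolySpred _ h_neq0) /= addnS.
exists (homogenize h * 'X_ord3_2 ^+ (N - (df + dh))); apply: (dehomogenize_inj W_homog).
  rewrite mulrA -[N in N.-homog](subnKC le_N).
  have X_homog k : ('X_ord3_2 ^+ k : {mpoly K[3]}) \is k.-homog.
    by rewrite -[X in X.-homog]mul1n; apply: dhomogMn; rewrite dhomogX; apply/eqP; apply: mdeg1.
  by apply: dhomogM => //; apply: dhomogM; apply: homogenize_homog.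
rewrite def_W /dehomogenize !rmorphM rmorphXn /= !homogenizeK comp_mpolyXU /=.
by rewrite expr1n mulr1.
Qed.

Lemma comp_homog n k (g : {mpoly K[n]}) (p : n.-tuple {mpoly K[k]}) e e' :
  g \is e.-homog -> (forall i, tnth p i \is e'.-homog) -> g \mPo p \is (e' * e).-homog.
Proof.
move=> g_homog p_homog; rewrite comp_mpolyEX big_seq rpred_sum // => a ag.
rewrite rpredZ // comp_mpolyX -(dhomog_mf g_homog ag) /= mdegE big_distrr /=.
apply: (big_ind2 (fun u v => u \is v.-homog)) => [|u1 v1 u2 v2|i _]; first exact: dhomog1.
  exact: dhomogM.
exact: dhomogMn.
Qed.

End Homogenization.

(** * Points at infinity and rational parametrizations *)

Lemma homogenize_zero (K : fieldType) (f : {mpoly K[2]}) (x y z : K) : z != 0 ->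
  (homogenize f).@[point3 x y z] = 0 -> f.@[point2 (x / z) (y / z)] = 0.
Proof.
move=> z_neq0; rewrite (homogeneous_eval _ _ z_neq0 (homogenize_homog f)).
rewrite /dehomogenize homogenizeK => /eqP.
by rewrite mulf_eq0 expf_eq0 (negPf z_neq0) andbF => /eqP.
Qed.

Lemma bform_zeros_bounded e (P : {poly rat}) : P != 0 -> (size P <= e.+1)%N ->
  exists2 B : int, 0 < B & forall s t : int, coprimez s t ->
    bform e P s%:~R t%:~R = 0 -> `|s| <= B /\ `|t| <= B.
Proof.
move=> P_neq0 P_size; have [B B_gt0 P_B] := root_height_bound P_neq0.
have B_ge1 : 1 <= B by rewrite -gtz0_ge1.
have B_sq : B <= B ^+ 2 by rewrite expr2 ler_peMl // ltW.
exists (B ^+ 2) => [|s t cop st0]; first by rewrite exprn_gt0.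
have [t0|t_neq0] := eqVneq t 0.
  have s_1 : `|s| = 1.
    by move: cop; rewrite t0 /coprimez gcdz0 => /eqP; rewrite abszE.
  by rewrite t0 normr0 s_1 exprn_ege1 // exprn_ge0 // ltW.
have t_rat : t%:~R != 0 :> rat by rewrite intr_eq0.
have P_root : root P (s%:~R / t%:~R).
  move/eqP: st0; rewrite bform_horner // mulf_eq0 expf_eq0 (negPf t_rat) andbF.
  by rewrite -rootE.
have [num_le den_le] := P_B _ P_root.
have [D [D_gt0 D_le]] := fraction_bound t_neq0 num_le den_le.
rewrite Gauss_dvdzl 1?coprimez_sym // => t_D s_le.
have t_le : `|t| <= B.
  apply: le_trans D_le; rewrite -[leRHS]gtr0_norm //.
  by apply: dvdz_norm_le => //; apply: lt0r_neq0.
split; last exact: le_trans t_le B_sq.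
by rewrite (le_trans s_le) // expr2 ler_wpM2l // ltW.
Qed.

Section Curve.
Variables (f : {mpoly rat[2]}) (f_irr : mirreducible f).

Lemma irreducible_neq0 : f != 0.
Proof. by case: f_irr. Qed.

(** On the line at infinity the equation of the curve is a nonzero binary form,
    the part of [f] of top degree. *)
Lemma infinity_bounded : exists2 B : int, 0 < B &
  forall x y : int, coprimez x y -> (homogenize f).@[point3 x%:~R y%:~R 0] = 0 ->
    `|x| <= B /\ `|y| <= B.
Proof.
pose T := homogenize f \mPo [tuple 'X_0; 'X_1; 0] : {mpoly rat[2]}.
pose d := (msize f).-1.
have T_homog : T \is d.-homog.
  rewrite -[d]mul1n; apply: comp_homog (homogenize_homog f) _.
  have X_homog (i : 'I_2) : ('X_i : {mpoly rat[2]}) \is 1.-homog.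
    by rewrite dhomogX; apply/eqP/mdeg1.
  by case=> [[|[|[]]]] //= lt_i; rewrite ?X_homog ?dhomog0.
have T_eval x y : T.@[point2 x y] = (homogenize f).@[point3 x y 0].
  rewrite /T comp_mpoly_meval; apply: meval_eq => -[[|[|[|[]]]] //= lt_i].
  - by rewrite (_ : Ordinal lt_i = ord0) ?mevalXU //; apply: val_inj.
  - by rewrite (_ : Ordinal lt_i = ord3_1) ?mevalXU //; apply: val_inj.
  - by rewrite (_ : Ordinal lt_i = ord3_2) ?meval0 //; apply: val_inj.
have T_neq0 : T != 0.
  have TE : T = \sum_(a <- msupp f) (f@_a * 0 ^+ (d - mdeg a)) *: 'X_[a].
    rewrite /T /homogenize raddf_sum /=; apply: eq_bigr => a _.
    rewrite comp_mpolyZ !rmorphM !rmorphXn /= !comp_mpolyXU /= -scalerA; congr (_ *: _).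
    rewrite -mul_mpolyC rmorphXn /= mpolyC0 mulrC; congr (_ * _).
    rewrite [RHS]mpolyXE_id !big_ord_recl big_ord0 mulr1.
    by congr ('X_ _ ^+ a _ * 'X_ _ ^+ a _); apply/val_inj.
  apply/eqP => T0; have := mcoeff0 rat (mlead f); rewrite -T0 TE raddf_sum /=.
  rewrite (bigD1_seq (mlead f)) ?msupp_uniq ?mlead_supp ?irreducible_neq0 //=.
  rewrite big1 => [|a /negPf neq_a]; last by rewrite mcoeffZ mcoeffX neq_a mulr0.
  rewrite addr0 mcoeffZ mcoeffX eqxx mulr1 /d -mlead_deg ?irreducible_neq0 // subnn mulr1.
  by move/eqP; rewrite mleadc_eq0 (negPf irreducible_neq0).
have P_neq0 : binary_dehomogenize d T != 0.
  apply: contraNneq T_neq0 => P0; apply/eqP/mpolyP=> a; rewrite mcoeff0.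
  have [deg_a|deg_a] := eqVneq (mdeg a) d; last exact: dhomog_nemf_coeff T_homog deg_a.
  have := coef0 rat (a ord0); rewrite -P0 coef_poly ltnS -deg_a mdeg2 leq_addr addKn => <-.
  by congr (_@_ _); apply: mon2P; rewrite ?mon2_0 ?mon2_1.
have [B B_gt0 P_B] := bform_zeros_bounded P_neq0 (size_poly _ _).
exists B => // x y cop F0; apply: P_B => //.
by rewrite -F0 -T_eval (bform_homog _ T_homog).
Qed.

(** The composite [q o p] is the identity of the curve wherever one of its
    coordinates [W i0] does not vanish, that is outside a bounded set: there
    [q(v)] is proportional to the point, with [v = p(x, y, z)], and rescaling
    [v] to coprime integers [(s, t)] only changes the factor. *)
Lemma rational_parametrization : rational_curve (homogenize f) ->
  exists (e : nat) (P : 'I_3 -> {poly rat}) (B : int),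
  [/\ 0 < B, forall i, (size (P i) <= e.+1)%N & forall x y z : int, z != 0 ->
      gcdz x (gcdz y z) = 1 -> (homogenize f).@[point3 x%:~R y%:~R z%:~R] = 0 ->
      [/\ `|x| <= B, `|y| <= B & `|z| <= B] \/
      exists (s t : int) (lambda : rat), [/\ coprimez s t, lambda != 0 &
        forall i, bform e (P i) s%:~R t%:~R = lambda * point3 x%:~R y%:~R z%:~R i]].
Proof.
move=> [p [q [[[e' p_homog] _ _] [[e q_homog] _ _] [[i0 W_ndvd] W_prop] _]]].
pose W i := tnth (comp_tuple q p) i; rewrite -/(W i0) in W_ndvd.
have WE i : W i = tnth q i \mPo p by rewrite /W tnth_mktuple.
have W_homog i : W i \is (e' * e).-homog by rewrite WE; apply: comp_homog.
have G_ndvd : ~ principal_ideal f (dehomogenize (W i0)).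
  by move/(dehomogenize_multiple irreducible_neq0 (W_homog i0)).
have [B B_gt0 G_B] := common_zeros_bounded f_irr G_ndvd.
exists e, (fun i => binary_dehomogenize e (tnth q i)), B; split=> // [i|x y z z_neq0 cop F0].
  exact: size_poly.
have z_rat : z%:~R != 0 :> rat by rewrite intr_eq0.
pose V := point3 x%:~R y%:~R z%:~R : 'I_3 -> rat.
have [W0|W_neq0] := eqVneq (W i0).@[V] 0.
  left; apply: G_B => //; first exact: homogenize_zero.
  move/eqP: W0; rewrite (homogeneous_eval _ _ z_rat (W_homog i0)).
  by rewrite mulf_eq0 expf_eq0 (negPf z_rat) andbF => /eqP.
right; have W_V i j : (W i).@[V] * V j = (W j).@[V] * V i.
  have [h /(congr1 (meval V))] := W_prop i j.
  rewrite mevalB !mevalM !mevalXU F0 mul0r => /eqP.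
  by rewrite subr_eq0 => /eqP.
have V_neq0 : V i0 != 0.
  apply: contraNneq W_neq0 => V0.
  have := W_V i0 ord3_2; rewrite V0 mulr0 => /eqP; rewrite mulf_eq0 => /orP[//|].
  by rewrite /V /point3 (tnth_nth 0) /= (negPf z_rat).
pose lambda := (W i0).@[V] / V i0.
have W_lambda j : (W j).@[V] = lambda * V j.
  by rewrite /lambda mulrAC W_V mulfK.
have [s [t [kappa [cop_st v0E v1E]]]] :=
  coprime_direction (tnth p ord0).@[V] (tnth p ord_max).@[V].
have W_bform j : (W j).@[V] = kappa ^+ e * bform e (binary_dehomogenize e (tnth q j)) s%:~R t%:~R.
  rewrite WE comp_mpoly_meval (bform_homog _ (q_homog j)) v0E v1E.
  exact: bform_scale.
have kappa_neq0 : kappa ^+ e != 0.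
  by apply: contraNneq W_neq0 => k0; rewrite W_bform k0 mul0r.
exists s, t, (lambda / kappa ^+ e); split=> // [|i].
  by rewrite mulf_neq0 ?invr_eq0 // mulf_neq0 ?invr_eq0.
apply: (mulfI kappa_neq0); rewrite -W_bform W_lambda -/(V i).
by rewrite mulrA mulrCA divff // mulr1.
Qed.

(** [binary_height] is applied to the three coordinates, which gives the exponent
    [e2], and to the first two, which are proportional to the coprime integers
    [x/g] and [y/g] and give the exponent [e1]. *)
Lemma rational_heights : rational_curve (homogenize f) ->
  exists (e1 e2 : nat) (C : int), 0 < C /\ forall x y z : int, z != 0 ->
    gcdz x (gcdz y z) = 1 -> (x, y) != (0, 0) ->
    (homogenize f).@[point3 x%:~R y%:~R z%:~R] = 0 ->
    [/\ `|x| <= C, `|y| <= C & `|z| <= C] \/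
    exists2 h : int, 1 <= h &
      [/\ `|x| <= C * h ^+ e2, `|y| <= C * h ^+ e2,
          h ^+ e2 <= C * (`|x| + `|y| + `|z|),
          `|x| + `|y| <= C * (h ^+ e1 * gcdz x y) &
          h ^+ e1 * gcdz x y <= C * (`|x| + `|y|)].
Proof.
move=> /rational_parametrization[e [P [B [B_gt0 P_size P_param]]]].
pose P2 (i : 'I_2) := P (widen_ord (leqnSn 2) i).
have [P2_neq0|P2_eq0] := pselect (exists i, P2 i != 0); last first.
  exists 0%N, 0%N, B; split=> // x y z z_neq0 cop xy_neq0 F0.
  have [|[s [t [lambda [_ l_neq0 PE]]]]] := P_param x y z z_neq0 cop F0; first by left.
  have P0 i : P2 i = 0 by apply/eqP; apply: contra_notT P2_eq0 => Pi; exists i.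
  case/negP: xy_neq0; apply/eqP; congr (_, _); apply/eqP; rewrite -(intr_eq0 rat).
    have := PE (widen_ord (leqnSn 2) ord0); rewrite -/(P2 _) P0 bform0.
    by move/esym/eqP; rewrite mulf_eq0 (negPf l_neq0).
  have := PE (widen_ord (leqnSn 2) ord_max); rewrite -/(P2 _) P0 bform0.
  by move/esym/eqP; rewrite mulf_eq0 (negPf l_neq0).
have P_neq0 : exists i, P i != 0 by case: P2_neq0 => i Pi; exists (widen_ord (leqnSn 2) i).
have [e2 [Q [w [Q_bpf PQ]]]] := remove_base_points P_size P_neq0.
have [e1 [Q2 [w2 [Q2_bpf PQ2]]]] :=
  remove_base_points (fun i => P_size (widen_ord (leqnSn 2) i)) P2_neq0.
have [C C_gt0 Q_C] := binary_height Q_bpf; have [C2 C2_gt0 Q2_C] := binary_height Q2_bpf.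
(* [C2 *+ 2] bounds [|a| + |b|] by a multiple of [h ^+ e1]. *)
exists e1, e2, (B + C + C2 *+ 2); split; first by rewrite !addr_gt0.
move=> x y z z_neq0 cop xy_neq0 F0.
have [[xB yB zB]|[s [t [lambda [cop_st l_neq0 PE]]]]] := P_param x y z z_neq0 cop F0.
  left; have le_B v : v <= B -> v <= B + C + C2 *+ 2.
    by move/le_trans; apply; rewrite -addrA lerDl addr_ge0 ?ltW // mulrn_wgt0.
  by split; apply: le_B.
right; have [a [b [def_x def_y cop_ab _ g_gt0]]] := gcd_split cop xy_neq0.
set g := gcdz x y in def_x def_y g_gt0 *.
pose h := Num.max `|s| `|t|.
have h_ge1 : 1 <= h.
  rewrite le_max -!gtz0_ge1 !normr_gt0 -negb_and; apply: contraTN cop_st => /andP[/eqP-> /eqP->].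
  by rewrite /coprimez gcdz0.
pose X := tnth [tuple x; y; z]; pose X2 := tnth [tuple a; b].
have w_neq0 : w s%:~R t%:~R != 0.
  have /eqP := PE ord3_2; rewrite PQ; apply: contraTneq => ->.
  by rewrite mul0r eq_sym mulf_neq0 // intr_eq0.
have [|i|X_le h_le] := Q_C s t h X (lambda / w s%:~R t%:~R) cop_st erefl.
- have [u [v [r uvr1]]] := coprime3_bezout cop; exists (tnth [tuple u; v; r]).
  by rewrite !big_ord_recl big_ord0 addr0 -uvr1 addrA.
- apply: (mulfI w_neq0); rewrite -PQ PE mulrA mulrCA divff // mulr1; congr (_ * _).
  by case: i => [[|[|[]]]].
have xyzE : \sum_i `|X i| = `|x| + `|y| + `|z|.
  by rewrite !big_ord_recl big_ord0 addr0 addrA.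
have gr_gt0 : 0 < g%:~R :> rat by rewrite ltr0z.
have V2E (i : 'I_2) : point3 x%:~R y%:~R z%:~R (widen_ord (leqnSn 2) i) = g%:~R * (X2 i)%:~R :> rat.
  case: i => [[|[]]] // lt_i; rewrite /point3 (tnth_nth 0) [X2 _](tnth_nth 0) /=;
    by rewrite -rmorphM /= -?def_x -?def_y.
have w2_neq0 : w2 s%:~R t%:~R != 0.
  apply: contraNneq xy_neq0 => w20.
  have V0 (i : 'I_2) : point3 x%:~R y%:~R z%:~R (widen_ord (leqnSn 2) i) = 0 :> rat.
    have /eqP := PE (widen_ord (leqnSn 2) i); rewrite PQ2 w20 mul0r eq_sym mulf_eq0.
    by rewrite (negPf l_neq0) => /eqP.
  have /eqP := V0 ord0; have /eqP := V0 ord_max; rewrite /point3 !(tnth_nth 0) /= !intr_eq0.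
  by move=> /eqP-> /eqP->.
have [|i|X2_le h2_le] := Q2_C s t h X2 (lambda * g%:~R / w2 s%:~R t%:~R) cop_st erefl.
- have /coprimezP[[u v] /= uv1] := cop_ab; exists (tnth [tuple u; v]).
  by rewrite !big_ord_recl big_ord0 addr0 -uv1.
- apply: (mulfI w2_neq0); rewrite -PQ2 PE V2E.
  by rewrite mulrA [RHS]mulrA; congr (_ * _); rewrite [RHS]mulrC divfK.
have abE : \sum_i `|X2 i| = `|a| + `|b| by rewrite !big_ord_recl big_ord0 addr0.
rewrite xyzE in h_le; rewrite abE in h2_le.
have x_le : `|x| <= C * h ^+ e2 by apply: (X_le ord3_0).
have y_le : `|y| <= C * h ^+ e2 by apply: (X_le ord3_1).
have a_le : `|a| <= C2 * h ^+ e1 by apply: (X2_le ord0).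
have b_le : `|b| <= C2 * h ^+ e1 by apply: (X2_le ord_max).
have h_ge0 : 0 <= h by apply: le_trans h_ge1.
have he1_ge0 : 0 <= h ^+ e1 by apply: exprn_ge0.
have he2_ge0 : 0 <= h ^+ e2 by apply: exprn_ge0.
have leC : C <= B + C + C2 *+ 2 by rewrite addrAC lerDr addr_ge0 ?ltW // mulrn_wgt0.
have leC2 : C2 *+ 2 <= B + C + C2 *+ 2 by rewrite lerDr addr_ge0 // ltW.
have leC2' : C2 <= B + C + C2 *+ 2 by apply: le_trans leC2; rewrite mulr2n lerDl ltW.
exists h => //; split.
- by apply: le_trans x_le _; apply: ler_wpM2r.
- by apply: le_trans y_le _; apply: ler_wpM2r.
- by apply: le_trans h_le _; apply: ler_wpM2r => //; rewrite !addr_ge0.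
- rewrite def_x def_y !normrM (gtr0_norm g_gt0) -mulrDr mulrA [leRHS]mulrC ler_pM2l //.
  apply: le_trans (lerD a_le b_le) _; rewrite -mulrDl -mulr2n.
  exact: ler_wpM2r.
rewrite def_x def_y !normrM (gtr0_norm g_gt0) -mulrDr mulrCA [leLHS]mulrC ler_pM2l //.
by apply: le_trans h2_le _; apply: ler_wpM2r => //; rewrite addr_ge0.
Qed.

End Curve.

(** * Real exponents *)

Section PowerBounds.
Variable R : realType.
Implicit Types (S : R -> R -> Prop) (M g B C alpha beta c : R).

(** [S] relates a size [M] to a gcd [g]. *)
Definition two_sided S alpha beta : Prop :=
  exists C1 C2 : R, [/\ 0 < C1, 0 < C2 &
    forall M g, S M g -> C1 * powR M alpha <= g <= C2 * powR M beta].

Lemma expr_powR_root g M C (k N : nat) : (0 < k)%N -> 0 <= g -> 0 <= M -> 0 <= C ->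
  g ^+ k <= C * M ^+ N -> g <= powR C k%:R^-1 * powR M (N%:R / k%:R).
Proof.
move=> k_gt0 g_ge0 M_ge0 C_ge0 le_gM.
have k_neq0 : k%:R != 0 :> R by rewrite pnatr_eq0 -lt0n.
rewrite -[leLHS]powRr1 // -[X in powR g X <= _](mulfV k_neq0) powRrM powR_mulrn //.
rewrite (powRrM M) powR_mulrn //.
rewrite -powRM ?exprn_ge0 // ge0_ler_powR ?nnegrE ?exprn_ge0 ?mulr_ge0 ?exprn_ge0 //.
by rewrite invr_ge0 ler0n.
Qed.

Lemma two_sided_bounded S alpha beta B : 0 <= beta ->
  (forall M g, S M g -> [/\ 1 <= g, g <= M & M <= B]) -> two_sided S alpha beta.
Proof.
move=> beta_ge0 S_B; pose B1 := Num.max 1 B; have B1_ge1 : 1 <= B1 by rewrite le_max lexx.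
have B1_gt0 : 0 < B1 by apply: lt_le_trans B1_ge1.
exists (powR B1 `|alpha|)^-1, B1; split; rewrite ?invr_gt0 ?powR_gt0 // => M g /S_B[g_ge1 gM MB].
have M_ge1 : 1 <= M by apply: le_trans gM.
have MB1 : M <= B1 by rewrite le_max MB orbT.
apply/andP; split.
  apply: le_trans g_ge1; rewrite mulrC ler_pdivrMr ?powR_gt0 // mul1r.
  apply: (@le_trans _ _ (powR M `|alpha|)); first by rewrite ler_powR // ler_norm.
  by rewrite ge0_ler_powR // nnegrE; apply: le_trans ler01 _.
rewrite (le_trans gM) // (le_trans MB1) // ler_peMr ?(ltW B1_gt0) //.
by rewrite -(powRr0 M) ler_powR.
Qed.

Lemma two_sided_union S S1 S2 alpha beta :
    (forall M g, S M g -> S1 M g \/ S2 M g) -> two_sided S1 alpha beta ->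
  two_sided S2 alpha beta -> two_sided S alpha beta.
Proof.
move=> S12 [C1 [C2 [C1_gt0 C2_gt0 S1_le]]] [D1 [D2 [D1_gt0 D2_gt0 S2_le]]].
exists (Num.min C1 D1), (Num.max C2 D2); split; rewrite ?lt_min ?lt_max ?C1_gt0 ?C2_gt0 //.
move=> M g /S12[/S1_le|/S2_le] /andP[le_g g_le]; apply/andP; split.
- by apply: le_trans le_g; rewrite ler_wpM2r ?powR_ge0 // ge_min lexx.
- by apply: le_trans g_le _; rewrite ler_wpM2r ?powR_ge0 // le_max lexx.
- by apply: le_trans le_g; rewrite ler_wpM2r ?powR_ge0 // ge_min lexx orbT.
- by apply: le_trans g_le _; rewrite ler_wpM2r ?powR_ge0 // le_max lexx orbT.
Qed.

(** If the larger exponent occurs on the smaller side, the variable is bounded. *)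
Lemma powR_gap_bounded K1 K2 M alpha beta : 0 < K1 -> 0 < K2 -> 1 <= M -> alpha < beta ->
  K1 * powR M beta <= K2 * powR M alpha -> M <= powR (K2 / K1) (beta - alpha)^-1.
Proof.
move=> K1_gt0 K2_gt0 M_ge1 lt_ab le_M; have M_gt0 : 0 < M by apply: lt_le_trans M_ge1.
have gap_gt0 : 0 < beta - alpha by rewrite subr_gt0.
rewrite -[leLHS]powRr1 ?(ltW M_gt0) // -(divff (lt0r_neq0 gap_gt0)) powRrM.
rewrite ge0_ler_powR ?nnegrE ?powR_ge0 ?divr_ge0 ?invr_ge0 //
  ?(ltW gap_gt0) ?(ltW K1_gt0) ?(ltW K2_gt0) //.
rewrite powRB ?(gt_eqF lt_ab) // ler_pdivrMr ?powR_gt0 // mulrAC ler_pdivlMr //.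
by rewrite mulrC.
Qed.

(** If [c] and [alpha] differ, the bounds with an exponent between them contradict
    those with exponent [c] as soon as [M] is large.  So either [c = alpha] or
    all values of [M] are bounded, and then any exponent will do. *)
Lemma exponent_pinned S alpha c B : 0 <= alpha ->
    (forall M g, S M g -> 1 <= g <= M) ->
    (forall epsilon, 0 < epsilon -> two_sided S (alpha - epsilon) (alpha + epsilon)) ->
    two_sided (fun M g => S M g /\ B < M) c c ->
  two_sided S alpha alpha.
Proof.
move=> alpha_ge0 S_gM S_eps [K1 [K2 [K1_gt0 K2_gt0 S_c]]].
have small B' : two_sided (fun M g => S M g /\ M <= B') alpha alpha.
  by apply: (@two_sided_bounded _ _ _ B') => // M g [/S_gM/andP[]].
have S_split M g : S M g -> (S M g /\ M <= B) \/ (S M g /\ B < M).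
  by have [MB|BM] := leP M B; [left|right].
apply: (two_sided_union S_split (small B)).
have [<-|neq_c] := eqVneq c alpha; first by exists K1, K2.
pose eps := `|alpha - c| / 2.
have eps_gt0 : 0 < eps by rewrite divr_gt0 // normr_gt0 subr_eq0 eq_sym.
have [L1 [L2 [L1_gt0 L2_gt0 S_L]]] := S_eps _ eps_gt0.
have [lt_c|le_c] := ltP c alpha.
  have lt_ce : c < alpha - eps.
    by rewrite /eps gtr0_norm ?subr_gt0 //; lra.
  apply: (@two_sided_bounded _ _ _ (powR (K2 / L1) (alpha - eps - c)^-1)) => // M g [SMg BM].
  have /andP[g_ge1 gM] := S_gM _ _ SMg; split=> //.
  apply: powR_gap_bounded => //; first exact: le_trans gM.
  have /andP[le_g _] := S_L _ _ SMg; have /andP[_ g_le] := S_c _ _ (conj SMg BM).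
  exact: le_trans g_le.
have lt_ce : alpha + eps < c.
  have lt_c : alpha < c by rewrite lt_neqAle eq_sym neq_c.
  by rewrite /eps ltr0_norm ?subr_lt0 //; lra.
apply: (@two_sided_bounded _ _ _ (powR (L2 / K1) (c - (alpha + eps))^-1)) => // M g [SMg BM].
have /andP[g_ge1 gM] := S_gM _ _ SMg; split=> //.
apply: powR_gap_bounded => //; first exact: le_trans gM.
have /andP[_ g_le] := S_L _ _ SMg; have /andP[le_g _] := S_c _ _ (conj SMg BM).
exact: le_trans g_le.
Qed.

(** From [M ~ h^e2] follows [h^e1 ~ M^(e1/e2)], and [g ~ M / h^e1]. *)
Lemma two_sided_param S C (e1 e2 : nat) : 0 < C -> (0 < e2)%N ->
    (forall M g, S M g -> exists2 h : R, 1 <= h & [/\ 1 <= g /\ 1 <= M,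
       M <= C * h ^+ e2, h ^+ e2 <= C * M, M <= C * (h ^+ e1 * g) & h ^+ e1 * g <= C * M]) ->
  two_sided S (1 - e1%:R / e2%:R) (1 - e1%:R / e2%:R).
Proof.
move=> C_gt0 e2_gt0 S_h; pose r : R := e1%:R / e2%:R.
have r_ge0 : 0 <= r by rewrite divr_ge0 ?ler0n.
have e2_neq0 : e2%:R != 0 :> R by rewrite pnatr_eq0 -lt0n.
have Cr_gt0 : 0 < powR C r by apply: powR_gt0.
exists (C * powR C r)^-1, (C * powR C r); rewrite invr_gt0 !mulr_gt0 //.
split=> // M g /S_h[h h_ge1 [[g_ge1 M_ge1] M_le M_ge Mg_le Mg_ge]].
have h_gt0 : 0 < h by apply: lt_le_trans h_ge1.
have M_gt0 : 0 < M by apply: lt_le_trans M_ge1.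
have g_gt0 : 0 < g by apply: lt_le_trans g_ge1.
have Mr_gt0 : 0 < powR M r by apply: powR_gt0.
have hE : h ^+ e1 = powR (h ^+ e2) r.
  by rewrite -!powR_mulrn ?(ltW h_gt0) // -powRrM mulrC divfK.
have h_le : h ^+ e1 <= powR C r * powR M r.
  rewrite hE -powRM ?(ltW C_gt0) ?(ltW M_gt0) //.
  by rewrite ge0_ler_powR // nnegrE ?exprn_ge0 ?mulr_ge0 ?(ltW C_gt0) ?(ltW h_gt0) ?(ltW M_gt0).
have le_h : powR M r <= powR C r * h ^+ e1.
  rewrite hE -powRM ?exprn_ge0 ?(ltW C_gt0) ?(ltW h_gt0) //.
  by rewrite ge0_ler_powR // nnegrE ?mulr_ge0 ?exprn_ge0 ?(ltW C_gt0) ?(ltW h_gt0) ?(ltW M_gt0).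
rewrite powRB ?lt0r_neq0 ?implybT // powRr1 ?(ltW M_gt0) //.
rewrite -/r; apply/andP; split.
  rewrite ler_pdivrMl ?mulr_gt0 // ler_pdivrMr //; apply: le_trans Mg_le _.
  by rewrite -!mulrA ler_pM2l // [g * _]mulrC mulrA ler_pM2r.
rewrite mulrA ler_pdivlMr //.
apply: (@le_trans _ _ (g * (powR C r * h ^+ e1))); first by rewrite ler_pM2l.
by rewrite mulrCA [C * _]mulrC -mulrA ler_pM2l // mulrC.
Qed.

End PowerBounds.

(** * The gcd of admissible triplets *)

Lemma coprime_at_infinity (x y : int) : gcdz x (gcdz y 0) = 1 -> coprimez x y.
Proof. by rewrite gcdzA gcdz0 => cop; apply/eqP. Qed.

Section Main.
Variables (R : realType) (f : {mpoly rat[2]}) (d m : nat) (delta : R).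
Hypotheses (f_irr : mirreducible f) (f_deg : has_degree f d) (f_ord : has_order f m).
Hypothesis delta_gt0 : 0 < delta.

Let F := homogenize f.

Definition size_gcd (P : int -> Prop) (M g : R) : Prop :=
  exists x y z : int, [/\ admissible F delta x y z, P z,
    M = (Num.max `|x| `|y|)%:~R & g = (gcdz x y)%:~R].

Lemma admissible_neq0 x y z : admissible F delta x y z -> (x, y) != (0, 0).
Proof.
case=> xyz_notin cop _ _; apply: contra xyz_notin => /eqP[x0 y0].
by move: cop; rewrite x0 y0 !gcd0z !inE !xpair_eqE /= => z_1; lia.
Qed.

Lemma size_gcd_ge1 P M g : size_gcd P M g -> 1 <= g <= M.
Proof.
move=> [x [y [z [adm _ -> ->]]]]; have xy_neq0 := admissible_neq0 adm.
have [_ cop _ _] := adm; have [a [b [_ _ _ _ g_gt0]]] := gcd_split cop xy_neq0.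
rewrite ler1z ler_int -gtz0_ge1 g_gt0 /= -[leLHS]gtr0_norm // le_max.
have [x0|x_neq0] := eqVneq x 0.
  have y_neq0 : y != 0 by apply: contraNneq xy_neq0 => ->; rewrite x0.
  by rewrite (dvdz_norm_le (dvdz_gcdr x y)) ?orbT.
by rewrite (dvdz_norm_le (dvdz_gcdl x y)).
Qed.

Lemma size_le_ratio x y z : admissible F delta x y z -> z != 0 ->
  `|z|%:~R <= delta^-1 * (Num.max `|x| `|y|)%:~R.
Proof.
case=> _ _ _; rewrite /max_ratio => + z_neq0; rewrite (negPf z_neq0) lee_fin.
have z_gt0 : 0 < `|z|%:~R :> R by rewrite ltr0z normr_gt0.
rewrite !normrM !normfV -!intr_norm le_max !ler_pdivlMr // ler_pdivlMl //.
by move=> /orP[] /le_trans; apply; rewrite ler_int le_max lexx ?orbT.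
Qed.

Lemma height_bound : exists2 A : R, 1 <= A & forall x y z, admissible F delta x y z ->
  z != 0 -> (Num.max (Num.max `|x| `|y|) `|z|)%:~R <= A * (Num.max `|x| `|y|)%:~R.
Proof.
exists (Num.max 1 delta^-1) => [|x y z adm z_neq0]; first by rewrite le_max lexx.
have M_ge0 : 0 <= (Num.max `|x| `|y|)%:~R :> R by rewrite ler0z le_max normr_ge0.
have [le_z|lt_M] := leP (`|z|) (Num.max `|x| `|y|).
  by rewrite ler_peMl // le_max lexx.
apply: le_trans (size_le_ratio adm z_neq0) _.
by rewrite ler_wpM2r // le_max lexx orbT.
Qed.

Lemma admissible_curve_point x y z : admissible F delta x y z -> z != 0 ->
  curve_point f x y z (Num.max (Num.max `|x| `|y|) `|z|).
Proof.
move=> adm z_neq0; have xy_neq0 := admissible_neq0 adm; case: adm => _ cop F0 _.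
split=> //; first by apply: homogenize_zero F0; rewrite intr_eq0.
by split; rewrite !le_max !lexx ?orbT.
Qed.

(** At infinity the gcd is [1], and there are finitely many points. *)
Lemma size_gcd_infinity alpha beta : 0 <= beta ->
  two_sided (size_gcd (fun z => z = 0)) alpha beta.
Proof.
have [B B_gt0 inf_B] := infinity_bounded f_irr.
move=> beta_ge0; apply: (@two_sided_bounded _ _ _ _ B%:~R) => // M g SMg.
have /andP[g_ge1 gM] := size_gcd_ge1 SMg; split=> //.
have [x [y [z [[_ cop F0 _] z0 -> _]]]] := SMg; rewrite z0 in cop F0.
by have [xB yB] := inf_B x y (coprime_at_infinity cop) F0; rewrite ler_int ge_max xB yB.
Qed.

(** With [k = d j], the exponents obtained from [gcd_upper] and [gcd_lower] are
    [m/d + 1/j] and [m/d - 3/j]; so [j > 3/epsilon] suffices. *)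
Lemma size_gcd_affine epsilon : 0 < epsilon ->
  two_sided (size_gcd (fun z => z != 0)) (m%:R / d%:R - epsilon) (m%:R / d%:R + epsilon).
Proof.
move=> eps_gt0; have d_gt0 := irreducible_degree_gt0 f_irr f_deg.
have le_md := order_le_degree f_deg f_ord.
pose j := Num.bound (3 / epsilon).
have j_gt : 3 / epsilon < j%:R by apply: archi_boundP; rewrite divr_ge0 ?ltW.
have jR_gt0 : 0 < j%:R :> R by apply: le_lt_trans j_gt; rewrite divr_ge0 ?ltW.
have j_gt0 : (0 < j)%N by rewrite -(ltr0n R).
have dR_gt0 : 0 < d%:R :> R by rewrite ltr0n.
have k_gt0 : (0 < d * j)%N by rewrite muln_gt0 d_gt0.
have j_eps : 3 / j%:R < epsilon by rewrite ltr_pdivrMr // mulrC -ltr_pdivrMr.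
have [A A_ge1 H_A] := height_bound; have A_ge0 : 0 <= A by apply: le_trans A_ge1.
have [C1 C1_gt0 up] := gcd_upper f_irr f_deg f_ord j.
have [C2 C2_gt0 low] := gcd_lower f_irr f_deg f_ord j_gt0.
set k := (d * j)%N in k_gt0 up low; pose N1 := (m * j + d)%N; pose N2 := ((d - m) * j + 3 * d)%N.
pose K1 := C1%:~R * A ^+ N1; pose K2 := C2%:~R * A ^+ N2.
have K1_gt0 : 0 < K1 by rewrite mulr_gt0 ?ltr0z // exprn_gt0 // (lt_le_trans ltr01).
have K2_gt0 : 0 < K2 by rewrite mulr_gt0 ?ltr0z // exprn_gt0 // (lt_le_trans ltr01).
exists (powR K2 k%:R^-1)^-1, (powR K1 k%:R^-1); split; rewrite ?invr_gt0 ?powR_gt0 // => M g SMg.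
have /andP[g_ge1 gM] := size_gcd_ge1 SMg; have M_ge1 : 1 <= M := le_trans g_ge1 gM.
have g_gt0 : 0 < g := lt_le_trans ltr01 g_ge1; have M_gt0 : 0 < M := lt_le_trans ltr01 M_ge1.
have [x [y [z [adm z_neq0 def_M def_g]]]] := SMg.
have [G def_G] : exists G, gcdz x y = G by exists (gcdz x y).
rewrite def_G in def_g.
have xyzH := admissible_curve_point adm z_neq0.
set H := Num.max (Num.max `|x| `|y|) `|z| in xyzH.
have H_le N (C : int) : 0 < C -> (C%:~R * H%:~R ^+ N <= C%:~R * A ^+ N * M ^+ N :> R).
  move=> C_gt0; rewrite -mulrA ler_pM2l ?ltr0z // -exprMn lerXn2r ?nnegrE ?mulr_ge0 ?(ltW M_gt0) //.
    by rewrite ler0z !le_max normr_ge0.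
  by rewrite def_M; apply: H_A.
apply/andP; split.
  have M_le : M ^+ k <= K2 * g ^+ k * M ^+ N2.
    have [] := low x y z H xyzH; rewrite def_G => x_le y_le.
    apply: (@le_trans _ _ (C2%:~R * H%:~R ^+ N2 * g ^+ k)).
      rewrite def_M def_g -!rmorphXn -!rmorphM /= ler_int.
      by rewrite /Num.max; case: ifP.
    rewrite [leRHS]mulrAC ler_wpM2r ?exprn_ge0 ?(ltW g_gt0) //; exact: H_le.
  have := expr_powR_root k_gt0 (ltW M_gt0) (ltW M_gt0) _ M_le.
  rewrite mulr_ge0 ?exprn_ge0 ?(ltW K2_gt0) ?(ltW g_gt0) // => /(_ isT).
  rewrite powRM ?exprn_ge0 ?(ltW K2_gt0) ?(ltW g_gt0) // -(powR_mulrn k (ltW g_gt0)) -powRrM.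
  rewrite divff ?pnatr_eq0 -?lt0n // powRr1 ?(ltW g_gt0) // => M_le'.
  have le_exp : m%:R / d%:R - epsilon <= 1 - N2%:R / k%:R.
    have -> : N2%:R / k%:R = 1 - m%:R / d%:R + 3 / j%:R :> R.
      rewrite /N2 /k natrD !natrM natrB //; field.
      by rewrite !lt0r_neq0.
    by rewrite opprD opprD opprK addrA addrA subrr add0r lerB // ltW.
  rewrite ler_pdivrMl ?powR_gt0 //; apply: le_trans (ler_powR M_ge1 le_exp) _.
  rewrite powRB ?lt0r_neq0 ?implybT // powRr1 ?(ltW M_gt0) // ler_pdivrMr ?powR_gt0 //.
have g_le : g ^+ k <= K1 * M ^+ N1.
  apply: le_trans (H_le N1 C1 C1_gt0).
  by rewrite def_g -!rmorphXn -!rmorphM /= ler_int -def_G; apply: (up _ _ _ _ xyzH).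
apply: le_trans (expr_powR_root k_gt0 (ltW g_gt0) (ltW M_gt0) (ltW K1_gt0) g_le) _.
rewrite ler_pM2l ?powR_gt0 // ler_powR //.
have -> : N1%:R / k%:R = m%:R / d%:R + 1 / j%:R :> R.
  rewrite /N1 /k natrD !natrM; field.
  by rewrite !lt0r_neq0.
rewrite lerD2l (le_trans _ (ltW j_eps)) // ler_pM2r ?invr_gt0 //; lra.
Qed.

Lemma order_ratio_ge0 : 0 <= m%:R / d%:R :> R.
Proof. by rewrite divr_ge0 ?ler0n. Qed.

Lemma size_gcd_epsilon epsilon : 0 < epsilon ->
  two_sided (size_gcd (fun=> True)) (m%:R / d%:R - epsilon) (m%:R / d%:R + epsilon).
Proof.
move=> eps_gt0; apply: two_sided_union (size_gcd_infinity _ _) (size_gcd_affine eps_gt0).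
  by move=> M g [x [y [z [adm _ def_M def_g]]]];
    have [z0|z0] := eqVneq z 0; [left|right]; exists x, y, z.
by rewrite addr_ge0 ?order_ratio_ge0 // ltW.
Qed.

(** If [e2 = 0] the size is bounded.  Otherwise [two_sided_param] provides bounds
    with the exact exponent [1 - e1/e2], and [exponent_pinned] identifies it. *)
Lemma size_gcd_rational : rational_curve F ->
  two_sided (size_gcd (fun=> True)) (m%:R / d%:R) (m%:R / d%:R).
Proof.
move=> /(rational_heights f_irr)[e1 [e2 [C [C_gt0 heights]]]].
have [B B_gt0 inf_B] := infinity_bounded f_irr.
pose S := size_gcd (fun=> True).
have large M g : S M g -> (B + C)%:~R < M -> exists x y z (h : int),
   [/\ [/\ admissible F delta x y z, z != 0, M = (Num.max `|x| `|y|)%:~R & g = (gcdz x y)%:~R],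
       1 <= h, `|x| <= C * h ^+ e2 /\ `|y| <= C * h ^+ e2,
       h ^+ e2 <= C * (`|x| + `|y| + `|z|) &
       `|x| + `|y| <= C * (h ^+ e1 * gcdz x y) /\
       h ^+ e1 * gcdz x y <= C * (`|x| + `|y|)].
  move=> [x [y [z [adm _ def_M def_g]]]] M_gt; have xy_neq0 := admissible_neq0 adm.
  have M_int : B + C < Num.max `|x| `|y| by rewrite -(ltr_int R) -def_M.
  have [_ cop F0 _] := adm.
  have z_neq0 : z != 0.
    apply: contraTneq M_int => z0; rewrite z0 in cop F0.
    have [xB yB] := inf_B x y (coprime_at_infinity cop) F0.
    by rewrite -leNgt ge_max !ler_wpDr // ltW.
  have [[xC yC _]|[h h_ge1 [? ? ? ? ?]]] := heights x y z z_neq0 cop xy_neq0 F0.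
    by move: M_int; rewrite ltNge ge_max !ler_wpDl // ltW.
  by exists x, y, z, h.
have [e2_0|e2_gt0] := posnP e2.
  apply: (@two_sided_bounded _ _ _ _ (B + C)%:~R) order_ratio_ge0 _ => M g SMg.
  have /andP[g_ge1 gM] := size_gcd_ge1 SMg; split=> //; rewrite leNgt; apply/negP => M_gt.
  have [x [y [z [h [[_ _ def_M _] _ [x_le y_le] _ _]]]]] := large M g SMg M_gt.
  move: M_gt; rewrite def_M ltr_int ltNge ge_max; move: x_le y_le.
  by rewrite e2_0 expr0 mulr1 => x_le y_le; rewrite !ler_wpDl // ltW.
apply: (exponent_pinned (c := 1 - e1%:R / e2%:R) (B := (B + C)%:~R) order_ratio_ge0).
- exact: size_gcd_ge1.
- exact: size_gcd_epsilon.
have CR_gt0 : 0 < C%:~R :> R by rewrite ltr0z.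
have di_gt0 : 0 < delta^-1 by rewrite invr_gt0.
(* [|x| + |y| + |z| <= (2 + delta^-1) M]. *)
apply: (two_sided_param (C := C%:~R * (2 + delta^-1)) _ e2_gt0) => [|M g [SMg M_gt]].
  by rewrite mulr_gt0 // addr_gt0.
have /andP[g_ge1 gM] := size_gcd_ge1 SMg; have M_ge1 : 1 <= M := le_trans g_ge1 gM.
have M_gt0 : 0 < M := lt_le_trans ltr01 M_ge1.
have [x [y [z [h [[adm z_neq0 def_M]]]]]] := large M g SMg M_gt.
move: (gcdz x y) => G def_g h_ge1 [x_le y_le] h_le [xy_le g_le].
have [xM yM] : `|x|%:~R <= M /\ `|y|%:~R <= M by rewrite def_M !ler_int !le_max !lexx orbT.
have zM := size_le_ratio adm z_neq0; rewrite -def_M in zM.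
have hR_ge1 : 1 <= h%:~R :> R by rewrite ler1z.
have hR_ge0 : 0 <= h%:~R :> R := le_trans ler01 hR_ge1.
have c_ge1 : 1 <= 2 + delta^-1 by rewrite -[leLHS]addr0 lerD ?ler1n // ltW.
have weaken (v : R) : 0 <= v -> C%:~R * v <= C%:~R * (2 + delta^-1) * v.
  by move=> v_ge0; rewrite -mulrA ler_pM2l // ler_peMl.
have M2 : M <= `|x|%:~R + `|y|%:~R.
  by rewrite -rmorphD /= def_M ler_int ge_max lerDl lerDr !normr_ge0.
have xy2 : `|x|%:~R + `|y|%:~R <= 2 * M by rewrite mulr2n mulrDl mul1r lerD.
exists h%:~R => //; split=> //.
- apply: le_trans (weaken _ (exprn_ge0 _ hR_ge0)).
  by rewrite def_M -rmorphXn -rmorphM /= ler_int ge_max x_le y_le.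
- apply: (@le_trans _ _ (C%:~R * (`|x|%:~R + `|y|%:~R + `|z|%:~R))).
    by rewrite -!rmorphD -rmorphXn -rmorphM /= ler_int.
  rewrite -mulrA ler_pM2l // mulrDl; exact: lerD.
- apply: (@le_trans _ _ (C%:~R * (h%:~R ^+ e1 * g))); last first.
    by apply: weaken; rewrite mulr_ge0 ?exprn_ge0 // (le_trans ler01).
  apply: le_trans M2 _; rewrite def_g -!rmorphD -rmorphXn -!rmorphM /= ler_int //.
apply: (@le_trans _ _ (C%:~R * (`|x|%:~R + `|y|%:~R))).
  by rewrite def_g -!rmorphD -rmorphXn -!rmorphM /= ler_int.
rewrite -mulrA ler_pM2l //; apply: le_trans xy2 _.
by rewrite ler_wpM2r ?(ltW M_gt0) // lerDl ltW.
Qed.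

End Main.

Theorem corollaryA7 (R : realType) (f : {mpoly rat[2]}) (d m : nat)
    (f_irr : mirreducible f) (f_deg : has_degree f d) (f_ord : has_order f m) :
  (forall epsilon delta : R, 0 < epsilon -> 0 < delta ->
    exists C1 C2 : R, [/\ 0 < C1, 0 < C2 &
      forall x y z : int, admissible (homogenize f) delta x y z ->
        C1 * powR (Num.max `|x| `|y|)%:~R (m%:R / d%:R - epsilon)
          <= (gcdz x y)%:~R
          <= C2 * powR (Num.max `|x| `|y|)%:~R (m%:R / d%:R + epsilon)]) /\
  (rational_curve (homogenize f) ->
   forall delta : R, 0 < delta ->
    exists C1 C2 : R, [/\ 0 < C1, 0 < C2 &
      forall x y z : int, admissible (homogenize f) delta x y z ->
        C1 * powR (Num.max `|x| `|y|)%:~R (m%:R / d%:R)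
          <= (gcdz x y)%:~R
          <= C2 * powR (Num.max `|x| `|y|)%:~R (m%:R / d%:R)]).
Proof.
split=> [epsilon delta eps_gt0 delta_gt0|f_rat delta delta_gt0].
  have [C1 [C2 [C1_gt0 C2_gt0 S_le]]] := size_gcd_epsilon f_irr f_deg f_ord delta_gt0 eps_gt0.
  by exists C1, C2; split=> // x y z adm; apply: S_le; exists x, y, z.
have [C1 [C2 [C1_gt0 C2_gt0 S_le]]] := size_gcd_rational f_irr f_deg f_ord delta_gt0 f_rat.
by exists C1, C2; split=> // x y z adm; apply: S_le; exists x, y, z.
Qed.
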